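(* For every integer $k\ge 1$, \begin{align*} &\sum_{n_k\ge \cdots\ge n_1 \ge 0} \frac{t^{n_1+\cdots+n_{k}} q^{n_1^2+\cdots + n_{k-1}^2}}{(q;q)_{n_k-n_{k-1}}\cdots (q;q)_{n_2-n_1} (q;q)_{n_1}}\sum_{j=0}^{2n_k} \begin{bmatrix} 2n_k\\ j\end{bmatrix}_q z^{2j - 2n_k}\\ &\qquad = \frac{1}{(t,tz^2,tz^{-2};q)_\infty}\sum_{n\ge 0} (-1)^n t^{(k+1)n} q^{kn^2+\binom{n}{2}} \frac{(q^{n+1};q)_n (t^2q^{2n};q)_\infty}{(tq^n;q)_n (tq^{2n+1};q)_\infty}\sum_{j=0}^{2n} \frac{(t;q)_j (t;q)_{2n-j}}{(q;q)_j (q;q)_{2n-j}}z^{2j-2n}. \end{align*} (For $k=1$ the left side is a single sum over $n_1\ge 0$ with no $q$-power factor.)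
   Context: Here $q,t,z$ are complex numbers (or indeterminates) with $|q|<1$, $|t|<1$, $z\neq 0$, generic enough that all denominators are nonzero and all series converge. The $q$-Pochhammer symbols are $(a;q)_\infty=\prod_{k\ge0}(1-aq^k)$, $(a;q)_n=(a;q)_\infty/(aq^n;q)_\infty$, and $(a_1,\dots,a_M;q)_n=(a_1;q)_n\cdots(a_M;q)_n$ (also for $n=\infty$). The $q$-binomial coefficient is $\begin{bmatrix} M\\ N\end{bmatrix}_q=\frac{(q;q)_M}{(q;q)_N(q;q)_{M-N}}$ for $0\le N\le M$ and $0$ otherwise. *)

(* Defs.v *)
From HB Require Import structures.
From mathcomp Require Import all_boot all_order all_algebra.
From mathcomp Require Export complex.
From mathcomp Require Import all_classical all_reals topology normedtype.
From mathcomp Require Import sequences.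
From mathcomp.analysis Require Export showcase.summability.

Set Implicit Arguments.
Unset Strict Implicit.
Unset Printing Implicit Defensive.

Import Order.TTheory GRing.Theory Num.Theory.
Import numFieldNormedType.Exports.

Local Open Scope classical_set_scope.
Local Open Scope ring_scope.

(* Stated over any numFieldType, which carries its norm topology canonically;
   used at K := R[i], the complex numbers over R : realType. *)
Section QSeries.
Variable K : numFieldType.
Implicit Types (a q t z : K) (k n : nat).

Definition qpochinf a q : K := limn (fun N => \prod_(i < N) (1 - a * q ^+ i)).

Definition qpochsinf (s : seq K) q : K := \prod_(a <- s) qpochinf a q.

Definition qpoch a q n : K := qpochinf a q / qpochinf (a * q ^+ n) q.

Definition qbinom q (M N : nat) : K :=
  if (N <= M)%N then qpoch q q M / (qpoch q q N * qpoch q q (M - N)) else 0.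

(* The index set n_k >= ... >= n_1 >= 0; the entry at position i is n_(i+1). *)
Definition chain k := {n : k.-tuple nat | sorted leq n}.

Definition chain_at k (n : chain k) (i : nat) : nat := nth 0%N (val n) i.

Definition lhs_term k q t z (n : chain k) : K :=
  let n_ := chain_at n in
  let m := n_ k.-1 in
  t ^+ (\sum_(i < k) n_ i) * q ^+ (\sum_(i < k.-1) n_ i ^ 2)
    / ((\prod_(i < k.-1) qpoch q q (n_ i.+1 - n_ i)) * qpoch q q (n_ 0%N))
  * \sum_(j < (2 * m).+1)
      qbinom q (2 * m) j * z ^ ((2 * j)%N%:Z - (2 * m)%N%:Z).

Definition rhs_term k q t z n : K :=
  (-1) ^+ n * t ^+ (k.+1 * n) * q ^+ (k * n ^ 2 + 'C(n, 2))
  * (qpoch (q ^+ n.+1) q n * qpochinf (t ^+ 2 * q ^+ (2 * n)) q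
     / (qpoch (t * q ^+ n) q n * qpochinf (t * q ^+ (2 * n).+1) q))
  * \sum_(j < (2 * n).+1)
      (qpoch t q j * qpoch t q (2 * n - j))
      / (qpoch q q j * qpoch q q (2 * n - j))
      * z ^ ((2 * j)%N%:Z - (2 * n)%N%:Z).

(* Multiple sums are unordered: the limit of finite partial sums along the
   directed set of finite subsets of the index type. *)
Definition multisum_cvg (I : choiceType) (f : I -> K) : Prop :=
  cvg (partial_sum f @ totally).

Definition multisum (I : choiceType) (f : I -> K) : K :=
  lim (partial_sum f @ totally).

Definition sum_nat_cvg (u : nat -> K) : Prop := cvgn (series u).

Definition sum_nat (u : nat -> K) : K := limn (series u).

End QSeries.

(* Main.v *)
Require Import Defs.
From mathcomp Require Import all_boot all_order all_algebra.
From mathcomp Require Import finmap ring zify.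
From mathcomp Require Import complex reals.
From mathcomp Require Import all_classical topology normedtype sequences.

Set Implicit Arguments.
Unset Strict Implicit.
Unset Printing Implicit Defensive.

Import Order.TTheory GRing.Theory Num.Theory.
Import numFieldNormedType.Exports.
Local Open Scope classical_set_scope.
Local Open Scope ring_scope.
Local Open Scope complex_scope.

(* The inner sum on the left is the continuous q-Hermite polynomial H_(2 n_k)
   and the one on the right is the Rogers polynomial C_(2n)(z; t | q).  Summing
   out n_1, ..., n_(k-1) on the left produces the sequence beta_n obtained from
   the unit Bailey pair relative to a = t by k steps of the Bailey chain, so
   that the left side is sum_n t^n H_(2n) beta_n.  Substituting
   beta_n = sum_r alpha_r / ((q)_(n-r) (tq)_(n+r)) and exchanging the sums, the
   theorem reduces to the conjugate Bailey pair
     sum_s t^s H_(2s+m) (t q^(s+m+1))_oo / (q)_s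
       = (q)_m (t^2 q^m)_oo C_m(z; t | q) / (t, t z^2, t z^-2)_oo
   for m = 2r.  Both sides satisfy the same three-term recurrence in m.  For
   m = 0 both sides satisfy the same first-order q-difference equation in t,
   which is iterated along t, tq, tq^2, ... down to the value 1 at t = 0.  On
   the left the recurrence and the q-difference equation hold because the
   corresponding combinations of summands telescope. *)

(** * Finite q-series *)

Section Finite.
Variable F : fieldType.
Implicit Types (a q t z : F).

(** A plain product, meaningful in any field. The [qpoch] of the statement is a ratio of infinite
    products; the two agree for |a| < 1 and |q| < 1 by [qpochE]. *)
Definition pochn a q n : F := \prod_(i < n) (1 - a * q ^+ i).

Lemma pochn0 a q : pochn a q 0 = 1.
Proof. exact: big_ord0. Qed.

Lemma pochnS a q n : pochn a q n.+1 = pochn a q n * (1 - a * q ^+ n).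
Proof. exact: big_ord_recr. Qed.

Lemma pochnSl a q n : pochn a q n.+1 = (1 - a) * pochn (a * q) q n.
Proof.
rewrite /pochn big_ord_recl expr0 mulr1; congr (_ * _).
by apply: eq_bigr => i _; rewrite /= exprS mulrA.
Qed.

Lemma pochnD a q m n : pochn a q (m + n) = pochn a q m * pochn (a * q ^+ m) q n.
Proof.
elim: n => [|n IH]; first by rewrite addn0 pochn0 mulr1.
by rewrite addnS !pochnS IH mulrA exprD mulrA.
Qed.

Lemma pochn_base0 q n : pochn 0 q n = 1.
Proof. by rewrite /pochn big1 // => i _; rewrite mul0r subr0. Qed.

(** Coefficient of x^n in (t x; q)_oo / (x; q)_oo, by the q-binomial theorem. *)
Definition rogers_coef q t n : F := pochn t q n / pochn q q n.

Definition rogers q t z m : F :=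
  \sum_(i < m.+1) rogers_coef q t i * rogers_coef q t (m - i)
                  * (z ^+ i / z ^+ (m - i)).

(** The q-Hermite polynomial as the case t = 0 of the Rogers polynomial, so that its recurrence is
    inherited from [rogersSS]. *)
Definition qhermite q z m : F := pochn q q m * rogers q 0 z m.

(** * Recurrences of the Rogers and q-Hermite polynomials *)

Section NonRoot.
Variable q : F.
Hypothesis q_nroot : forall n, 1 - q ^+ n.+1 != 0.

Lemma pochnq_neq0 n : pochn q q n != 0.
Proof. by apply/prodf_neq0 => i _; rewrite -exprS. Qed.

Lemma rogers_coefS t n :
  (1 - q ^+ n.+1) * rogers_coef q t n.+1 = (1 - t * q ^+ n) * rogers_coef q t n.
Proof.
have qn := q_nroot n; have Pn := pochnq_neq0 n.
by rewrite /rogers_coef !pochnS -exprS; field; rewrite Pn qn.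
Qed.

Lemma rogers0 t z : rogers q t z 0 = 1.
Proof.
rewrite /rogers big_ord1 subnn expr0 /rogers_coef !pochn0.
by rewrite !divr1 !mulr1.
Qed.

(* The auxiliary sum weighted by q^i turns the three-term recurrence into a
   first-order system for the pair (rogers, rogers_twist). *)
Definition rogers_twist t z m : F :=
  \sum_(i < m.+1) q ^+ i * (rogers_coef q t i * rogers_coef q t (m - i)
                  * (z ^+ i / z ^+ (m - i))).

(** The factor 1 - q^i kills the term i = 0 and lowers the first coefficient by [rogers_coefS];
    shifting i then leaves sums of degree m. *)
Lemma rogers_shiftl t z m :
  \sum_(i < m.+2) (1 - q ^+ i) * (rogers_coef q t i * rogers_coef q t (m.+1 - i)
                  * (z ^+ i / z ^+ (m.+1 - i)))
  = z * (rogers q t z m - t * rogers_twist t z m).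
Proof.
rewrite big_ord_recl expr0 subrr mul0r add0r /rogers /rogers_twist.
rewrite [t * _]mulr_sumr -sumrB mulr_sumr; apply: eq_bigr => i _.
rewrite lift0 subSS.
have := rogers_coefS t i; set c := rogers_coef q t i.+1 => e.
transitivity ((1 - q ^+ i.+1) * c * (rogers_coef q t (m - i)
   * (z ^+ i.+1 / z ^+ (m - i)))); first by ring.
by rewrite e exprS; ring.
Qed.

(** Mirror image of [rogers_shiftl]: here the last term dies and the second coefficient is
    lowered. *)
Lemma rogers_shiftr t z m : z != 0 ->
  \sum_(i < m.+2) q ^+ i * (1 - q ^+ (m.+1 - i))
     * (rogers_coef q t i * rogers_coef q t (m.+1 - i)
                  * (z ^+ i / z ^+ (m.+1 - i)))
  = z^-1 * (rogers_twist t z m - t * q ^+ m * rogers q t z m).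
Proof.
move=> z0; rewrite big_ord_recr /= subnn expr0 subrr mulr0 mul0r addr0.
rewrite /rogers /rogers_twist.
rewrite [_ * q ^+ m * _]mulr_sumr -sumrB mulr_sumr; apply: eq_bigr => i _.
have im : (i <= m)%N by rewrite -ltnS.
rewrite subSn // -[in q ^+ m](subnKC im) exprD.
have := rogers_coefS t (m - i).
set c := rogers_coef _ _ (m - i).+1 => e.
transitivity (q ^+ i * rogers_coef q t i * (z ^+ i / z ^+ (m - i).+1)
   * ((1 - q ^+ (m - i).+1) * c)); first by ring.
rewrite e exprS; field.
by rewrite z0 expf_neq0.
Qed.

Lemma rogers_twistS t z m :
  rogers_twist t z m.+1 = rogers q t z m.+1 - z * (rogers q t z m - t * rogers_twist t z m).
Proof.
rewrite -rogers_shiftl /rogers_twist /rogers -sumrB; apply: eq_bigr => i _.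
by ring.
Qed.

(** Follows from 1 - q^(m+1) = (1 - q^i) + q^i (1 - q^(m+1-i)) applied termwise. *)
Lemma rogers_stepS t z m : z != 0 ->
  (1 - q ^+ m.+1) * rogers q t z m.+1
  = z * (rogers q t z m - t * rogers_twist t z m)
    + z^-1 * (rogers_twist t z m - t * q ^+ m * rogers q t z m).
Proof.
move=> z0; rewrite -rogers_shiftl -rogers_shiftr // -big_split mulr_sumr /=.
apply: eq_bigr => i _; have im : (i <= m.+1)%N by rewrite -ltnS.
by rewrite -[in q ^+ m.+1](subnKC im) exprD; ring.
Qed.

Lemma rogers1 t z : z != 0 ->
  (1 - q) * rogers q t z 1 = (z + z^-1) * (1 - t).
Proof.
move=> z0; have := rogers_stepS t 0 z0.
rewrite rogers0 /rogers_twist big_ord1 /rogers_coef !pochn0 !expr0 expr1 => ->.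
by rewrite !divr1; ring.
Qed.

Lemma rogersSS t z m : z != 0 ->
  (1 - q ^+ m.+2) * rogers q t z m.+2
  = (z + z^-1) * (1 - t * q ^+ m.+1) * rogers q t z m.+1
    - (1 - t ^+ 2 * q ^+ m) * rogers q t z m.
Proof.
move=> z0; have e1 := rogers_stepS t m.+1 z0; have e0 := rogers_stepS t m z0.
rewrite e1 rogers_twistS.
set T := rogers_twist t z m; rewrite -/T in e0.
(* [T] is eliminated by adding z t times the difference of the two sides of [e0], which is zero. *)
transitivity (z * (rogers q t z m.+1 - t * (rogers q t z m.+1
    - z * (rogers q t z m - t * T))) + z^-1 * ((rogers q t z m.+1
    - z * (rogers q t z m - t * T)) - t * q ^+ m.+1 * rogers q t z m.+1)
    + z * t * ((1 - q ^+ m.+1) * rogers q t z m.+1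
    - (z * (rogers q t z m - t * T) + z^-1 * (T - t * q ^+ m * rogers q t z m)))).
  by rewrite e0 subrr mulr0 addr0.
by rewrite exprS; field.
Qed.

Lemma qhermite0 z : qhermite q z 0 = 1.
Proof. by rewrite /qhermite rogers0 pochn0 mulr1. Qed.

Lemma qhermite1 z : z != 0 -> qhermite q z 1 = z + z^-1.
Proof.
move=> z0; rewrite /qhermite pochnS pochn0 mul1r expr0 mulr1 rogers1 //.
by rewrite subr0 mulr1.
Qed.

Lemma qhermiteSS z m : z != 0 ->
  qhermite q z m.+2 = (z + z^-1) * qhermite q z m.+1
                      - (1 - q ^+ m.+1) * qhermite q z m.
Proof.
move=> z0; rewrite /qhermite pochnS -mulrA -exprS rogersSS // pochnS -exprS.
by ring.
Qed.

End NonRoot.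
End Finite.

Lemma sum_triangle (V : nmodType) (f : nat -> nat -> V) n :
  \sum_(s < n) \sum_(r < s.+1) f s r
  = \sum_(r < n) \sum_(i < n - r) f (r + i)%N r.
Proof.
elim: n => [|n IH]; first by rewrite !big_ord0.
rewrite big_ord_recr IH [RHS]big_ord_recr /= subSn // subnn big_ord1 addn0.
rewrite [\sum_(i < n.+1) _]big_ord_recr /= addrA; congr (_ + _).
rewrite -big_split; apply: eq_bigr => r _ /=.
by rewrite subSn 1?ltnW // big_ord_recr /= subnKC // ltnW.
Qed.

(** * The Bailey chain relative to a = t, and telescoping sums *)

Section Bailey.
Variables (F : fieldType) (q : F).
Hypothesis q_nroot : forall n, 1 - q ^+ n.+1 != 0.

Let Pq_neq0 := pochnq_neq0 q_nroot.

(** A limiting case of the q-Chu-Vandermonde sum, multiplied by (T q)_N so that it is polynomial in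
    T and needs no condition on T. Splitting 1 - q^(N+1) as (1 - q^(N+1-i)) + q^(N+1-i) (1 - q^i)
    reduces it to the case N at T and at T q. *)
Lemma q_vandermonde (T : F) N :
  \sum_(i < N.+1) T ^+ i * q ^+ (i ^ 2) * pochn (T * q ^+ i.+1) q (N - i)
     / (pochn q q i * pochn q q (N - i)) = (pochn q q N)^-1.
Proof.
elim: N T => [|N IH] T.
  by rewrite big_ord1 !pochn0 !expr0 !mul1r invr1.
apply: (mulfI (q_nroot N)).
transitivity ((1 - T * q ^+ N.+1) * (pochn q q N)^-1
              + T * q ^+ N.+1 * (pochn q q N)^-1); last first.
  have h1 := q_nroot N; have h2 := Pq_neq0 N.
  by rewrite pochnS -exprS; field; rewrite h1 h2.
rewrite -{1}(IH T) -(IH (T * q)) !mulr_sumr.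
transitivity (\sum_(i < N.+2) ((1 - q ^+ (N.+1 - i))
      * (T ^+ i * q ^+ (i ^ 2) * pochn (T * q ^+ i.+1) q (N.+1 - i)
     / (pochn q q i * pochn q q (N.+1 - i)))
   + q ^+ (N.+1 - i) * (1 - q ^+ i)
      * (T ^+ i * q ^+ (i ^ 2) * pochn (T * q ^+ i.+1) q (N.+1 - i)
     / (pochn q q i * pochn q q (N.+1 - i))))).
  apply: eq_bigr => i _; have iN : (i <= N.+1)%N by rewrite -ltnS.
  by rewrite -[in q ^+ N.+1](subnK iN) exprD; ring.
rewrite big_split /=; congr (_ + _).
  rewrite big_ord_recr /= subnn expr0 subrr mul0r addr0.
  apply: eq_bigr => i _; have iN : (i <= N)%N by rewrite -ltnS.
  rewrite subSn // !pochnS -exprS.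
  have -> : T * q ^+ i.+1 * q ^+ (N - i) = T * q ^+ N.+1.
    by rewrite -mulrA -exprD addSn subnKC.
  have h1 := q_nroot (N - i); have h2 := Pq_neq0 (N - i); have h3 := Pq_neq0 i.
  by field; rewrite h1 h2 h3.
rewrite big_ord_recl expr0 subrr mulr0 mul0r add0r.
apply: eq_bigr => i _; have iN : (i <= N)%N by rewrite -ltnS.
rewrite lift0 subSS pochnS -exprS.
have -> : T * q * q ^+ i.+1 = T * q ^+ i.+2 by rewrite -mulrA -exprS.
have -> : q ^+ N.+1 = q ^+ (N - i) * q ^+ i * q by rewrite -exprD subnK // exprSr.
have -> : q ^+ (i.+1 ^ 2) = q ^+ (i ^ 2) * q ^+ i * q ^+ i * q.
  by rewrite -!exprD -exprSr; congr (_ ^+ _); rewrite -addn1 sqrnD muln1 exp1n; lia.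
have h1 := q_nroot i; have h2 := Pq_neq0 (N - i); have h3 := Pq_neq0 i.
by rewrite exprMn [T ^+ i.+1]exprS; field; rewrite h1 h2 h3.
Qed.

Variable t : F.
Hypothesis t_nroot : forall n, 1 - t * q ^+ n != 0.

Lemma pochntq_neq0 n : pochn (t * q) q n != 0.
Proof. by apply/prodf_neq0 => i _; rewrite -mulrA -exprS. Qed.

(** The alpha half of the unit Bailey pair relative to a = t. *)
Definition unit_alpha r : F :=
  (-1) ^+ r * q ^+ 'C(r, 2) * (1 - t * q ^+ (2 * r)) * pochn t q r
  / ((1 - t) * pochn q q r).

(** Closed form of the partial sums, which makes an induction on m possible; at m = n the factor 1 -
    q^(n-m) makes the full sum vanish. *)
Lemma unit_alpha_sum n m : (m <= n)%N -> (0 < n)%N ->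
  \sum_(r < m.+1) unit_alpha r / (pochn q q (n - r) * pochn (t * q) q (n + r))
  = (-1) ^+ m * q ^+ 'C(m.+1, 2) * pochn (t * q) q m * (1 - q ^+ (n - m))
    / (pochn q q m * pochn q q (n - m) * pochn (t * q) q (n + m) * (1 - q ^+ n)).
Proof.
move=> + n0; have qn : 1 - q ^+ n != 0 by case: n n0.
have t1 : 1 - t != 0 by have := t_nroot 0; rewrite expr0 mulr1.
elim: m => [_|m IH mn].
  rewrite big_ord1 /unit_alpha !bin_small // subn0 addn0 !pochn0 muln0 !expr0.
  by field; rewrite qn t1 Pq_neq0 pochntq_neq0.
rewrite big_ord_recr /= IH 1?ltnW // /unit_alpha pochnSl.
(* Writing n = m + 1 + d removes truncated subtraction, so that all powers of q become monomials in
   q, q^m and q^d. *)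
have [d nE] : exists d, n = (m.+1 + d)%N by exists (n - m.+1)%N; rewrite subnKC.
have -> : (n - m = d.+1)%N by lia.
have -> : (n - m.+1 = d)%N by lia.
rewrite addnS [pochn q q d.+1]pochnS [pochn q q m.+1]pochnS.
rewrite [pochn (t * q) q (n + m).+1]pochnS [pochn (t * q) q m.+1]pochnS.
have tE j : t * q * q ^+ j = t * q ^+ j.+1 by rewrite -mulrA -exprS.
rewrite !tE -!exprS.
have h1 := Pq_neq0 m; have h2 := Pq_neq0 d; have h3 := pochntq_neq0 (n + m).
have h4 := q_nroot m; have h5 := q_nroot d.
have h6 := t_nroot (n + m).+1.
rewrite [in 'C(m.+2, 2)]binS bin1 exprD [(-1) ^+ m.+1]exprS.
have qE : q ^+ n = q ^+ m.+1 * q ^+ d by rewrite nE exprD.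
have qE2 : q ^+ (n + m).+1 = q ^+ m.+1 * q ^+ n by rewrite -exprD; congr (_ ^+ _); lia.
have qE3 : q ^+ (2 * m.+1) = q ^+ m.+1 * q ^+ m.+1 by rewrite -exprD; congr (_ ^+ _); lia.
rewrite qE3; rewrite qE2 in h6 *.
rewrite qE in qn h6 *; rewrite [q ^+ d.+1]exprS in h5 *.
have -> : q ^+ m.+1 = q * q ^+ m by rewrite exprS.
rewrite exprS in h4 qn h6.
field.
by rewrite ?h1 ?h2 ?h3 ?h4 ?h5 ?h6 ?t1 ?qn.
Qed.

Lemma unit_bailey_pair n :
  \sum_(r < n.+1) unit_alpha r / (pochn q q (n - r) * pochn (t * q) q (n + r))
  = (n == 0)%:R.
Proof.
case: n => [|n].
  rewrite big_ord1 /unit_alpha !bin_small // subn0 addn0 !pochn0 muln0 !expr0.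
  have t1 : 1 - t != 0 by have := t_nroot 0; rewrite expr0 mulr1.
  by rewrite eqxx /=; field; rewrite oner_neq0.
by rewrite unit_alpha_sum // subnn expr0 subrr mulr0 mul0r.
Qed.

(** The Bailey lemma with both free parameters sent to infinity. After the exchange of sums, with s
    = r + i, the inner sum is [q_vandermonde] at T = t q^(2r) and N = n - r. *)
Lemma bailey_step (alpha : nat -> F) n :
  \sum_(s < n.+1) t ^+ s * q ^+ (s ^ 2) / pochn q q (n - s)
    * (\sum_(r < s.+1) alpha r / (pochn q q (s - r) * pochn (t * q) q (s + r)))
  = \sum_(r < n.+1) t ^+ r * q ^+ (r ^ 2) * alpha r
     / (pochn q q (n - r) * pochn (t * q) q (n + r)).
Proof.
under eq_bigr do rewrite mulr_sumr.
rewrite (sum_triangle (fun s r => t ^+ s * q ^+ (s ^ 2) / pochn q q (n - s)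
  * (alpha r / (pochn q q (s - r) * pochn (t * q) q (s + r))))).
apply: eq_bigr => r _; have rn : (r <= n)%N by rewrite -ltnS.
rewrite subSn //; set N := (n - r)%N; set T := t * q ^+ (2 * r).
have D i : pochn (t * q) q (r + i + r) = pochn (t * q) q (2 * r) * pochn (T * q) q i.
  by rewrite /T mulrAC -pochnD; congr (pochn _ _ _); lia.
have T0 i : pochn (T * q) q i != 0.
  by have := pochntq_neq0 (r + i + r); rewrite D mulf_eq0 negb_or => /andP[].
have -> : (n + r = r + N + r)%N by rewrite /N; lia.
rewrite D; have h1 := pochntq_neq0 (2 * r); have h2 := T0 N; have h3 := Pq_neq0 N.
transitivity (t ^+ r * q ^+ (r ^ 2) * alpha r
   / (pochn (t * q) q (2 * r) * pochn (T * q) q N) * (pochn q q N)^-1); last first.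
  by field; rewrite h1 h2 h3.
rewrite -(q_vandermonde T N) mulr_sumr; apply: eq_bigr => i _.
have iN : (i <= N)%N by rewrite -ltnS.
rewrite subnDA -/N addKn D.
have -> : pochn (T * q) q N = pochn (T * q) q i * pochn (T * q ^+ i.+1) q (N - i).
  by rewrite -[in LHS](subnKC iN) pochnD -mulrA -exprS.
have h4 : pochn (T * q ^+ i.+1) q (N - i) != 0.
  have := T0 N; rewrite -[in pochn _ _ N](subnKC iN) pochnD mulf_eq0 negb_or.
  by rewrite -mulrA -exprS => /andP[].
have -> : q ^+ ((r + i) ^ 2) = q ^+ (r ^ 2) * q ^+ (i ^ 2) * (q ^+ (2 * r)) ^+ i.
  by rewrite -exprM -!exprD; congr (_ ^+ _); rewrite sqrnD; lia.
have h5 := Pq_neq0 (N - i); have h6 := Pq_neq0 i; have h7 := T0 i.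
rewrite exprD /T exprMn -/T; field.
by rewrite h1 h4 h5 h6 h7.
Qed.

(** Level 0 is the beta half of the unit pair; every further level is one application of
    [bailey_step]. *)
Fixpoint bailey_beta k n : F :=
  if k is k'.+1 then
    \sum_(s < n.+1) t ^+ s * q ^+ (s ^ 2) / pochn q q (n - s) * bailey_beta k' s
  else (n == 0)%:R.

Lemma bailey_chain k n :
  bailey_beta k n
  = \sum_(r < n.+1) (t ^+ r * q ^+ (r ^ 2)) ^+ k * unit_alpha r
     / (pochn q q (n - r) * pochn (t * q) q (n + r)).
Proof.
elim: k n => [|k IH] n /=.
  by rewrite -unit_bailey_pair; apply: eq_bigr => r _; rewrite expr0 mul1r.
under eq_bigr do rewrite IH.
rewrite (bailey_step (fun r => (t ^+ r * q ^+ (r ^ 2)) ^+ k * unit_alpha r)).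
apply: eq_bigr => r _.
by rewrite exprS !mulrA.
Qed.

(* h s stands for (t q^s; q)_oo, of which only the functional equation matters
   here. *)
Section Telescope.
Variables (z : F) (h : nat -> F).
Hypothesis z_neq0 : z != 0.
Hypothesis hE : forall s, h s = (1 - t * q ^+ s) * h s.+1.

Let X := z + z^-1.
Let H := qhermite q z.
Let g m s := t ^+ s * h (s + m).+1 / pochn q q s.

Lemma telescope_rec0 N :
  \sum_(s < N.+1) (X * (1 - t) * g 0 s * H (2 * s)
     - (1 - t ^+ 2) * g 1 s * H (2 * s).+1)
  = - ((1 - t) * (1 - q ^+ (2 * N.+1)) * g 0 N.+1 * H (2 * N).+1).
Proof.
elim: N => [|N IH].
  rewrite big_ord1 /g /H !muln0 qhermite0 qhermite1 // !expr0 pochnS pochn0.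
  rewrite [h (0 + 0).+1]hE !addn0 addn1 !expr0 !expr1 -/X.
  have q0 := q_nroot 0; rewrite expr1 in q0.
  by field; rewrite q0 ?oner_neq0.
rewrite big_ord_recr IH /=.
have -> : (2 * N.+1 = (2 * N).+2)%N by lia.
have -> : H (2 * N).+3 = X * H (2 * N).+2 - (1 - q ^+ (2 * N).+2) * H (2 * N).+1.
  exact: qhermiteSS.
have -> : q ^+ (2 * N.+2) = (q ^+ N.+2) ^+ 2 by rewrite -exprM; congr (_ ^+ _); lia.
rewrite /g !addn0 addn1 [h N.+2]hE [pochn q q N.+2]pochnS -exprS.
have h1 := q_nroot N.+1; have h2 := Pq_neq0 N.+1.
rewrite [t ^+ N.+2]exprS.
by field; rewrite h1 h2.
Qed.

(** The boundary term vanishes at N = 0 by the functional equation [hE]; its increments match the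
    summand by the recurrence of [H]. *)
Lemma telescope_recS m N :
  \sum_(s < N) (X * (1 - t * q ^+ m.+1) * g m.+1 s * H (2 * s + m).+1
     - (1 - t ^+ 2 * q ^+ m.+1) * g m.+2 s * H (2 * s + m).+2
     - (1 - q ^+ m.+1) * g m s * H (2 * s + m))
  = ((1 - q ^+ m.+1) * g m N
     - (1 - t * q ^+ m.+1) * (1 - q ^+ (2 * N + m).+1) * g m.+1 N) * H (2 * N + m).
Proof.
elim: N => [|N IH].
  rewrite big_ord0 /g muln0 !add0n [h m.+1]hE expr0 pochn0.
  by ring.
rewrite big_ord_recr IH /=.
have -> : (2 * N.+1 + m = (2 * N + m).+2)%N by lia.
have -> : H (2 * N + m).+2
          = X * H (2 * N + m).+1 - (1 - q ^+ (2 * N + m).+1) * H (2 * N + m).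
  exact: qhermiteSS.
have E3 : q ^+ (2 * N + m).+3 = q ^+ N.+1 * q ^+ N.+1 * q ^+ m.+1.
  by rewrite -!exprD; congr (_ ^+ _); lia.
have E1 : q ^+ (N + m).+2 = q ^+ N.+1 * q ^+ m.+1.
  by rewrite -!exprD; congr (_ ^+ _); lia.
rewrite /g !addnS !addSn [h (N + m).+1]hE [h (N + m).+2]hE E3 [pochn q q N.+1]pochnS -exprS.
have h1 := q_nroot N; have h2 := Pq_neq0 N.
rewrite E1 [t ^+ N.+1]exprS.
by field; rewrite h1 h2.
Qed.

(** Since h (s + 2) stands for (t q q^(s+1); q)_oo, the weight q^s [g 1 s] is [g 0 s] with t
    replaced by t q. This is therefore the finite form of the q-difference equation in t. *)
Lemma telescope_fun N :
  \sum_(s < N.+1) ((1 - t * z ^+ 2) * (1 - t * z ^- 2) * g 0 s * H (2 * s)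
     - (1 + t) * (1 - t ^+ 2 * q) * (q ^+ s * g 1 s) * H (2 * s))
  = t * (1 - q ^+ (2 * N).+2) * (1 - q ^+ (2 * N).+1) * g 0 N.+1 * H (2 * N)
    - t * g 0 N * H (2 * N).+2.
Proof.
(* In terms of X the coefficient is a polynomial, which the recurrence of [H] can absorb. *)
have XE : (1 - t * z ^+ 2) * (1 - t * z ^- 2) = (1 + t) ^+ 2 - t * X ^+ 2.
  by rewrite /X; field.
rewrite XE; elim: N => [|N IH].
  rewrite big_ord1 /g muln0 /H !qhermiteSS // qhermite1 // qhermite0 -/X.
  rewrite [h (0 + 0).+1]hE !addn0 addn1 !expr0 !expr1 pochnS pochn0 expr0.
  have q0 := q_nroot 0; rewrite expr1 in q0.
  by field; rewrite q0 ?oner_neq0.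
rewrite big_ord_recr IH /=.
have -> : (2 * N.+1 = (2 * N).+2)%N by lia.
have -> : H (2 * N).+4 = X * H (2 * N).+3 - (1 - q ^+ (2 * N).+3) * H (2 * N).+2.
  exact: qhermiteSS.
have -> : H (2 * N).+3 = X * H (2 * N).+2 - (1 - q ^+ (2 * N).+2) * H (2 * N).+1.
  exact: qhermiteSS.
have -> : H (2 * N).+2 = X * H (2 * N).+1 - (1 - q ^+ (2 * N).+1) * H (2 * N).
  exact: qhermiteSS.
have h1 := q_nroot N; have h2 := Pq_neq0 N; have h3 := q_nroot N.+1.
rewrite /g !addn0 !addn1 [h N.+1]hE [h N.+2]hE !pochnS -!exprS.
rewrite [t ^+ N.+2]exprS [t ^+ N.+1]exprS.
rewrite [q ^+ (2 * N).+4]exprS [q ^+ (2 * N).+3]exprS [q ^+ (2 * N).+2]exprS.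
rewrite [q ^+ (2 * N).+1]exprS mulnC exprM.
rewrite [q ^+ N.+2]exprS [q ^+ N.+1]exprS in h1 h3 *.
by field; rewrite h1 h2 h3.
Qed.

End Telescope.
End Bailey.

(** * Absolutely convergent series *)

Section AbsSummable.
Variable K : numFieldType.
Implicit Types (u v d : nat -> K) (l : K).

(** A bound on the partial sums of norms, so that comparison arguments involve no limits. *)
Definition abs_summable u := exists M : K, forall N, \sum_(n < N) `|u n| <= M.

Definition has_sum u l := series u @ \oo --> l.

Lemma abs_summable_bound u : abs_summable u ->
  exists2 M : K, 0 <= M & forall N, \sum_(n < N) `|u n| <= M.
Proof.
case=> M uM; exists M => //; apply: le_trans (uM 0%N).
by rewrite big_ord0.
Qed.

Lemma abs_summable_le u v C : 0 <= C -> (forall n, `|u n| <= C * `|v n|) ->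
  abs_summable v -> abs_summable u.
Proof.
move=> C0 uv [M vM]; exists (C * M) => N.
apply: (@le_trans _ _ (\sum_(n < N) C * `|v n|)).
  exact: ler_sum.
by rewrite -mulr_sumr ler_wpM2l.
Qed.

Lemma abs_summable_geometric (x : K) : `|x| < 1 -> abs_summable (fun n => x ^+ n).
Proof.
move=> x1; have x10 : 0 < 1 - `|x| by rewrite subr_gt0.
exists (1 - `|x|)^-1 => N.
under eq_bigr do rewrite normrX.
rewrite -[leRHS]mul1r ler_pdivlMr // mulrC.
have -> : (1 - `|x|) * (\sum_(i < N) `|x| ^+ i) = 1 - `|x| ^+ N.
  by rewrite -opprB mulNr -subrX1 opprB.
by rewrite lerBlDr lerDl exprn_ge0.
Qed.

Lemma eq_cvgn (f g : nat -> K) (l : K) : f =1 g -> f @ \oo --> l -> g @ \oo --> l.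
Proof. by move=> /funext ->. Qed.

Lemma cvgn_unique (f : nat -> K) (l l' : K) :
  f @ \oo --> l -> f @ \oo --> l' -> l = l'.
Proof. by move=> fl fl'; apply: (cvg_unique _ fl fl'). Qed.

Lemma has_sum_lim u l : has_sum u l -> limn (series u) = l.
Proof. by move=> ul; apply: cvg_lim. Qed.

Lemma has_sumD u v l m : has_sum u l -> has_sum v m ->
  has_sum (fun n => u n + v n) (l + m).
Proof.
move=> ul vm; rewrite /has_sum.
have -> : series (fun n => u n + v n) = series u + series v.
  by rewrite -seriesD.
exact: cvgD.
Qed.

Lemma has_sumZ (c : K) u l : has_sum u l -> has_sum (fun n => c * u n) (c * l).
Proof.
move=> ul; rewrite /has_sum.
have -> : series (fun n => c * u n) = (fun n => c * series u n).
  by apply/funext => n; rewrite /series /= mulr_sumr.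
exact: cvgMl_tmp.
Qed.

Lemma has_sumB u v l m : has_sum u l -> has_sum v m ->
  has_sum (fun n => u n - v n) (l - m).
Proof.
move=> ul vm; rewrite -mulN1r.
have -> : (fun n => u n - v n) = (fun n => u n + -1 * v n).
  by apply/funext => n; rewrite mulN1r.
exact/has_sumD/has_sumZ.
Qed.

(* The library's comparison lemmas for limits need a total order. *)
Lemma cvg_norm_le (x : nat -> K) l (M : K) (N : nat) : x @ \oo --> l ->
  (forall n, (N <= n)%N -> `|x n| <= M) -> `|l| <= M.
Proof.
move=> /cvgrPdist_le xl xM; apply/ler_addgt0Pr => e e0.
have [n [nN xn]] : exists n, (N <= n)%N /\ `|l - x n| <= e.
  have [n0 _ H] := xl e e0.
  exists (maxn N n0); split; first exact: leq_maxl.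
  by apply: H; rewrite /= leq_maxr.
rewrite -[l](subrK (x n)) addrC; apply: le_trans (ler_normD _ _) _.
exact: lerD (xM _ nN) xn.
Qed.

(* The only property of the complex numbers that the argument uses. *)
Hypothesis K_complete : forall u, abs_summable u -> cvgn (series u).

Lemma abs_summable_has_sum u : abs_summable u -> has_sum u (limn (series u)).
Proof. exact: K_complete. Qed.

Lemma abs_summable_cvg0 u : abs_summable u -> u @ \oo --> 0.
Proof. by move=> /K_complete /cvg_series_cvg_0. Qed.

Lemma abs_summable_tail d (e : K) : abs_summable d -> 0 < e ->
  exists N, forall m n, (N <= m)%N -> \sum_(m <= k < n) `|d k| <= e.
Proof.
move=> [M dM] e0.
have /K_complete /cvg_cauchy /cauchy_seriesP /(_ _ e0) [[A B] [/= HA HB] AB] :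
    abs_summable (fun n => `|d n|).
  by exists M => N; under eq_bigr do rewrite normr_id.
have [a _ Ha] := HA; have [b _ Hb] := HB.
exists (maxn a b) => m n mab.
have am : (a <= m)%N by apply: leq_trans mab; rewrite leq_maxl.
have bm : (b <= m)%N by apply: leq_trans mab; rewrite leq_maxr.
have [mn|nm] := leqP m n; last by rewrite big_geq ?ltW // ltnW.
have := AB (m, n) (conj (Ha m am) (Hb n (leq_trans bm mn))).
rewrite /= ger0_norm ?sumr_ge0 // => /ltW.
exact.
Qed.

(** If the terms beyond N sum to at most 1/2, they multiply the product by at most 2: from (1 - s -
    x)(1 + x) <= 1 - s, the tail product times one minus the tail sum is at most 1. *)
Lemma prod_1D_bounded d : abs_summable d ->
  exists M : K, forall n, \prod_(i < n) (1 + `|d i|) <= M.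
Proof.
move=> sd; have h0 : 0 < 2^-1 :> K by rewrite invr_gt0.
have [N tl] := abs_summable_tail sd h0.
set p := fun n => \prod_(i < n) (1 + `|d i|).
have p_ge0 n : 0 <= p n by apply: prodr_ge0 => i _; rewrite addr_ge0.
have p_mono m n : (m <= n)%N -> p m <= p n.
  move=> mn; rewrite -(subnKC mn); elim: (n - m)%N => [|j IH]; first by rewrite addn0.
  apply: le_trans IH _; rewrite addnS /p big_ord_recr /= ler_peMr ?p_ge0 //.
  by rewrite lerDl.
have p_tail n : (1 - \sum_(N <= k < N + n) `|d k|) * p (N + n)%N <= p N.
  elim: n => [|n IH]; first by rewrite addn0 big_geq // subr0 mul1r.
  apply: le_trans IH; rewrite addnS big_nat_recr ?leq_addr //=.
  rewrite /p big_ord_recr /= -/(p _) mulrCA [leRHS]mulrC; apply: ler_wpM2l => //.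
  set s := \sum_(_ <= k < _) _; set x := `|_|.
  have s0 : 0 <= s by apply: sumr_ge0.
  have x0 : 0 <= x by apply: normr_ge0.
  have -> : (1 - (s + x)) * (1 + x) = 1 - s - (s * x + x ^+ 2) by ring.
  by rewrite lerBlDr lerDl addr_ge0 ?mulr_ge0 ?exprn_ge0.
exists (2 * p N) => n; apply: le_trans (p_mono n (N + n)%N (leq_addl _ _)) _.
rewrite mulrC -ler_pdivrMr // mulrC; apply: le_trans (p_tail n).
apply: ler_wpM2r => //.
have := tl N (N + n)%N (leqnn _); set s := \sum_(_ <= k < _) _ => hs.
rewrite lerBrDr -lerBrDl; apply: le_trans hs _.
by rewrite -subr_ge0 le_eqVlt; apply/orP; left; apply/eqP; field.
Qed.

(** Exchange of the two summations under a domination in r and r + s. The sum of the first n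
    [gamma r] exceeds the triangular partial sum by the tails of the rows f r from n - r on, and
    these are bounded by |x r| times one tail of d starting at n. *)
Lemma has_sum_triangle (f : nat -> nat -> K) (x d gamma : nat -> K) :
  (forall r s, `|f r s| <= `|x r| * `|d (r + s)%N|) ->
  abs_summable x -> abs_summable d ->
  (forall r, has_sum (f r) (gamma r)) ->
  abs_summable gamma /\
  has_sum (fun n => \sum_(r < n.+1) f r (n - r)%N) (limn (series gamma)).
Proof.
move=> fxd sx sd fg; have [M M0 dM] := abs_summable_bound sd.
have [X X0 xX] := abs_summable_bound sx.
have sg : abs_summable gamma.
  apply: (@abs_summable_le _ x M) => // r.
  apply: (@cvg_norm_le (series (f r)) _ _ 0) => [|n _]; first exact: fg.
  rewrite /series /= big_mkord; apply: le_trans (ler_norm_sum _ _ _) _.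
  apply: (@le_trans _ _ (\sum_(s < n) `|x r| * `|d (r + s)%N|)).
    by apply: ler_sum => s _.
  rewrite -mulr_sumr mulrC; apply: ler_wpM2r => //.
  apply: le_trans (dM (r + n)%N); rewrite big_split_ord /= lerDr.
  exact: sumr_ge0.
split=> //.
pose delta n := \sum_(r < n) (gamma r - \sum_(s < n - r) f r s).
have delta0 : delta @ \oo --> 0.
  (* Division by X + 1 because the bound X may be zero. *)
  apply/cvgr0Pnorm_le => e e0; pose e' := e / (X + 1).
  have X1 : 0 < X + 1 by rewrite ltr_wpDl.
  have e'0 : 0 < e' by rewrite divr_gt0.
  have [N tl] := abs_summable_tail sd e'0.
  exists N => // n /= Nn; apply: le_trans (ler_norm_sum _ _ _) _.
  apply: (@le_trans _ _ (\sum_(r < n) `|x r| * e')).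
    apply: ler_sum => r _; have rn : (r <= n)%N by exact: ltnW.
    apply: (@cvg_norm_le (fun m => series (f r) m - \sum_(s < n - r) f r s) _ _ (n - r)).
      by apply: cvgB; [exact: fg|exact: cvg_cst].
    move=> m nrm.
    have -> : \sum_(s < n - r) f r s = series (f r) (n - r)%N.
      by rewrite /series /= big_mkord.
    rewrite sub_series_geq //; apply: le_trans (ler_norm_sum _ _ _) _.
    apply: (@le_trans _ _ (\sum_(n - r <= s < m) `|x r| * `|d (s + r)%N|)).
      by apply: ler_sum => s _; rewrite addnC.
    rewrite -mulr_sumr; apply: ler_wpM2l => //.
    have := tl n (m + r)%N Nn.
    by rewrite -{1}(subnK rn) big_addn addnK.
  rewrite -mulr_suml /e' mulrCA; apply: ler_piMr; first exact: ltW.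
  by rewrite ler_pdivrMr // mul1r (le_trans (xX n)) // lerDl.
rewrite /has_sum.
have -> : series (fun n => \sum_(r < n.+1) f r (n - r)%N) = series gamma - delta.
  apply/funext => n; rewrite /series /= big_mkord.
  rewrite (sum_triangle (fun n r => f r (n - r)%N)).
  apply/eqP; rewrite eq_sym -[X in X == _]/(series gamma n - delta n) subr_eq.
  rewrite /series /= big_mkord -big_split /=; apply/eqP/eq_bigr => r _.
  by under [X in _ = X + _]eq_bigr do rewrite addKn; rewrite subrKC.
rewrite -[limn _]subr0; apply: cvgB => //.
exact: K_complete.
Qed.

End AbsSummable.
Arguments has_sumZ {K} c {u l}.

(** * Completeness of the complex numbers *)

Section Complex.
Variable R : realType.
Local Notation K := (R[i] : numFieldType).

Lemma cvg_complex (x y : nat -> R) (a b : R) :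
  x @ \oo --> a -> y @ \oo --> b ->
  (fun n => (x n +i* y n : K)) @ \oo --> (a +i* b : K).
Proof.
move=> /cvgrPdist_lt xa /cvgrPdist_lt yb.
apply/cvgrPdist_lt => e e0.
(* A positive element of R[i] is real, so e can be halved between the two coordinates. *)
have eE : e = (complex.Re e)%:C by rewrite RRe_real // gtr0_real.
have e'0 : 0 < complex.Re e / 2 by rewrite divr_gt0 // -ltcR -eE.
have {}xa := xa _ e'0; have {}yb := yb _ e'0.
near=> n.
have -> : (a +i* b) - (x n +i* y n) = (a - x n)%:C + (0 +i* (b - y n)) :> R[i].
  by apply/eqP; rewrite eq_complex /= addr0 add0r !eqxx.
apply: le_lt_trans (ler_normD _ _) _.
have nR (w : R) : `|w%:C| = `|w|%:C :> R[i].
  by rewrite normc_def /= expr0n addr0 sqrtr_sqr.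
have nI (w : R) : `|0 +i* w| = `|w|%:C :> R[i].
  by rewrite normc_def /= expr0n add0r sqrtr_sqr.
rewrite nR nI -rmorphD /= eE ltcR (splitr (complex.Re e)); apply: ltrD.
  by near: n.
by near: n.
Unshelve. all: by end_near. Qed.

(** Provides [K_complete] for R[i]: real and imaginary parts are dominated by the norm, so both real
    series converge absolutely. *)
Lemma abs_summable_complex (u : nat -> K) : abs_summable u -> cvgn (series u).
Proof.
case=> M uM.
have real_cvg (f : nat -> R) : (forall n, `|f n|%:C <= `|u n|) -> cvgn (series f).
  move=> fu; apply: normed_cvg; apply: nondecreasing_is_cvgn.
    by move=> m n mn; apply: (@nondecreasing_series _ (fun i => `|f i|) xpredT 0%N).
  exists (complex.Re M) => _ [N _ <-]; rewrite -lecR.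
  have -> : [normed series f] N = \sum_(n < N) `|f n|.
    by rewrite -(big_mkord xpredT (fun n => `|f n|)).
  rewrite rmorph_sum /=.
  have MR : (complex.Re M)%:C = M.
    by rewrite RRe_real // ger0_real // (le_trans _ (uM 0%N)) // big_ord0.
  by rewrite MR; apply: le_trans (uM N); apply: ler_sum => n _.
have cRe : cvgn (series (fun n => complex.Re (u n))).
  by apply: real_cvg => n; apply: normc_ge_Re.
have cIm : cvgn (series (fun n => complex.Im (u n))).
  apply: real_cvg => n; rewrite normc_def lecR -sqrtr_sqr ler_wsqrtr //.
  by rewrite lerDr sqr_ge0.
apply/cvg_ex.
exists (limn (series (fun n => complex.Re (u n)))
        +i* limn (series (fun n => complex.Im (u n)))).
have -> : series u = (fun n => (series (fun n => complex.Re (u n)) n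
                                +i* series (fun n => complex.Im (u n)) n)).
  apply/funext => n; rewrite /series /=.
  elim/big_ind3: _ => //.
  - by move=> a b [c c'] e f [g g'] -> ->.
  - by move=> i _; case: (u i).
exact: cvg_complex.
Qed.

End Complex.

(** * Infinite products *)

Section InfinitePochhammer.
Variable K : numFieldType.
Hypothesis K_complete : forall u : nat -> K, abs_summable u -> cvgn (series u).
Variable q : K.
Hypothesis q_lt1 : `|q| < 1.

Lemma abs_summable_geometricZ (a : K) : abs_summable (fun n => a * q ^+ n).
Proof.
apply: (@abs_summable_le _ _ (fun n => q ^+ n) `|a|) => //.
  by move=> n; rewrite normrM.
exact: abs_summable_geometric.
Qed.

Lemma pochn_bounded (a : K) : exists2 M : K, 0 <= M & forall n, `|pochn a q n| <= M.
Proof.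
have [M pM] := prod_1D_bounded K_complete (abs_summable_geometricZ a).
have aM n : `|pochn a q n| <= M.
  apply: le_trans (pM n); rewrite /pochn normr_prod; apply: ler_prod => i _.
  by rewrite normr_ge0 /= (le_trans (ler_normB _ _)) // normr1.
by exists M => //; apply: le_trans (aM 0%N).
Qed.

Lemma norm_mulXn_lt1 (a : K) n : `|a| < 1 -> `|a * q ^+ n| < 1.
Proof.
move=> a1; rewrite normrM normrX (le_lt_trans _ a1) // ler_piMr //.
by rewrite exprn_ile1 // ltW.
Qed.

Lemma one_sub_neq0 (a : K) : `|a| < 1 -> 1 - a != 0.
Proof.
by move=> a1; rewrite subr_eq0; apply/eqP => e; rewrite -e normr1 ltxx in a1.
Qed.

Lemma pochn_neq0 (a : K) n : `|a| < 1 -> pochn a q n != 0.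
Proof.
by move=> a1; apply/prodf_neq0 => i _; apply/one_sub_neq0/norm_mulXn_lt1.
Qed.

(* 1 / (1 - x) = 1 + x / (1 - x) reduces this to a product of factors 1 + x. *)
Lemma pochnV_bounded (a : K) : `|a| < 1 ->
  exists2 M : K, 0 <= M & forall n, `|(pochn a q n)^-1| <= M.
Proof.
move=> a1; have a10 : 0 < 1 - `|a| by rewrite subr_gt0.
have [M pM] := prod_1D_bounded K_complete (abs_summable_geometricZ (a / (1 - `|a|))).
have aM n : `|(pochn a q n)^-1| <= M.
  apply: le_trans (pM n); rewrite /pochn -prodfV normr_prod.
  apply: ler_prod => i _; rewrite normr_ge0 /=.
  set x := a * q ^+ i.
  have xa : `|x| <= `|a|.
    by rewrite normrM ler_piMr // normrX exprn_ile1 // ltW.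
  have x1 : 1 - x != 0 by apply: one_sub_neq0; apply: le_lt_trans a1.
  have -> : (1 - x)^-1 = 1 + x / (1 - x) by field.
  apply: le_trans (ler_normD _ _) _; rewrite normr1 lerD2l.
  have -> : a / (1 - `|a|) * q ^+ i = x / (1 - `|a|) by rewrite mulrAC.
  rewrite normrM [leRHS]normrM !normfV; apply: ler_wpM2l => //.
  rewrite [ `|1 - `|a| |]gtr0_norm // lef_pV2 ?posrE ?normr_gt0 //.
  apply: le_trans (_ : 1 - `|x| <= _); first by rewrite lerD2l lerN2.
  by rewrite -{1}[1](@normr1 K); apply: lerB_dist.
by exists M => //; apply: le_trans (aM 0%N).
Qed.

(** Consecutive partial products differ by - a q^n (a; q)_n, a bounded multiple of a geometric term,
    so they are partial sums of an absolutely convergent series. *)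
Lemma pochn_cvg (a : K) : pochn a q @ \oo --> qpochinf a q.
Proof.
have [M M0 pM] := pochn_bounded a.
have : abs_summable (fun n => - (a * q ^+ n) * pochn a q n).
  apply: (@abs_summable_le _ _ (fun n => a * q ^+ n) M) => //.
    by move=> n; rewrite normrM normrN mulrC ler_wpM2r.
  exact: abs_summable_geometricZ.
move=> /K_complete cu.
have pE : pochn a q = (fun n => 1 + series (fun n => - (a * q ^+ n) * pochn a q n) n).
  apply/funext => n; rewrite /series /= big_mkord.
  elim: n => [|n IH]; first by rewrite pochn0 big_ord0 addr0.
  by rewrite big_ord_recr /= addrA -IH pochnS; ring.
have : cvgn (pochn a q).
  by rewrite pE; apply: is_cvgD => //; exact: is_cvg_cst.
exact.
Qed.

Lemma qpochinf_split (a : K) n : qpochinf a q = pochn a q n * qpochinf (a * q ^+ n) q.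
Proof.
have c1 : (fun m => pochn a q (n + m)) @ \oo --> qpochinf a q.
  by under eq_fun do rewrite addnC; have := @pochn_cvg a; rewrite -(cvg_shiftn n).
have c2 : (fun m => pochn a q (n + m)) @ \oo --> pochn a q n * qpochinf (a * q ^+ n) q.
  under eq_fun do rewrite pochnD.
  by apply: cvgMl_tmp; apply: pochn_cvg.
by apply: (cvg_unique _ c1 c2).
Qed.

(** The inverses of the partial products stay bounded, so the partial products cannot approach 0. *)
Lemma qpochinf_neq0 (a : K) : `|a| < 1 -> qpochinf a q != 0.
Proof.
move=> a1; have [M M0 pM] := pochnV_bounded a1.
apply/eqP => a0; have /cvgrPdist_lt := @pochn_cvg a; rewrite a0.
have M1 : 0 < (M + 1)^-1 by rewrite invr_gt0 ltr_wpDl.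
move=> /(_ _ M1) [N _ /(_ N (leqnn N))]; rewrite sub0r normrN.
have pN : 0 < `|pochn a q N| by rewrite normr_gt0 pochn_neq0.
rewrite -ltf_pV2 ?posrE // invrK -normfV => h.
have := lt_le_trans h (pM N).
by rewrite gtrDl ltr10.
Qed.

Lemma qpochE (a : K) n : `|a| < 1 -> qpoch a q n = pochn a q n.
Proof.
move=> a1; rewrite /qpoch (qpochinf_split a n) mulfK //.
exact/qpochinf_neq0/norm_mulXn_lt1.
Qed.

Lemma qpochinf_tail (a : K) : `|a| < 1 ->
  (fun n => qpochinf (a * q ^+ n) q) @ \oo --> (1 : K).
Proof.
move=> a1; have a0 := qpochinf_neq0 a1.
have -> : (fun n => qpochinf (a * q ^+ n) q) = (fun n => qpochinf a q * (pochn a q n)^-1).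
  apply/funext => n; rewrite (qpochinf_split a n) mulrAC mulfV ?mul1r //.
  exact: pochn_neq0.
rewrite -(divff a0); apply: cvgMl_tmp; apply: cvgV => //.
exact: pochn_cvg.
Qed.

Lemma qpochinf_tail_bounded (a : K) : `|a| < 1 ->
  exists2 M : K, 0 <= M & forall n, `|qpochinf (a * q ^+ n) q| <= M.
Proof.
move=> a1; have [M M0 pM] := pochnV_bounded a1.
exists (`|qpochinf a q| * M) => [|n]; first exact: mulr_ge0.
have -> : qpochinf (a * q ^+ n) q = qpochinf a q * (pochn a q n)^-1.
  rewrite (qpochinf_split a n) mulrAC mulfV ?mul1r //; exact: pochn_neq0.
by rewrite normrM ler_wpM2l.
Qed.

End InfinitePochhammer.

(** * The conjugate Bailey pair *)

Section Bounded.
Variable K : numFieldType.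
Implicit Types (c d : nat -> K).

Definition bounded_seq c := exists2 B : K, 0 <= B & forall s, `|c s| <= B.

Lemma bounded_seq_cst (a : K) : bounded_seq (fun=> a).
Proof. by exists `|a|. Qed.

Lemma bounded_seqM c d : bounded_seq c -> bounded_seq d ->
  bounded_seq (fun s => c s * d s).
Proof.
move=> [B B0 cB] [D D0 dD]; exists (B * D) => [|s]; first exact: mulr_ge0.
by rewrite normrM ler_pM.
Qed.

Lemma bounded_seqB c d : bounded_seq c -> bounded_seq d ->
  bounded_seq (fun s => c s - d s).
Proof.
move=> [B B0 cB] [D D0 dD]; exists (B + D) => [|s]; first exact: addr_ge0.
by rewrite (le_trans (ler_normB _ _)) // lerD.
Qed.

Lemma bounded_seqX (a : K) (e : nat -> nat) : `|a| < 1 -> bounded_seq (fun s => a ^+ e s).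
Proof.
by move=> a1; exists 1 => // s; rewrite normrX exprn_ile1 // ltW.
Qed.

End Bounded.

(** * Growth of the q-Hermite polynomials *)

Section Hermite.
Variable K : numFieldType.
Hypothesis K_complete : forall u : nat -> K, abs_summable u -> cvgn (series u).
Variables q z : K.
Hypothesis q_lt1 : `|q| < 1.
Hypothesis z_neq0 : z != 0.

Lemma q_nroot n : 1 - q ^+ n.+1 != 0.
Proof. by rewrite exprS; apply/one_sub_neq0/norm_mulXn_lt1. Qed.

(** The Laurent sum |z|^(-n) + |z|^(2-n) + ... + |z|^n, a Chebyshev polynomial of the second kind;
    up to a constant it majorizes H_n. *)
Definition laurent_maj n : K := \sum_(i < n.+1) `|z| ^+ i / `|z| ^+ (n - i).

Lemma laurent_maj_ge0 n : 0 <= laurent_maj n.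
Proof. by apply: sumr_ge0 => i _; rewrite divr_ge0 ?exprn_ge0. Qed.

Lemma laurent_majS n : laurent_maj n.+1 <= (`|z| + `|z|^-1) * laurent_maj n.
Proof.
have nz0 : `|z| != 0 by rewrite normr_eq0.
rewrite /laurent_maj big_ord_recl expr0 subn0 mul1r addrC mulrDl; apply: lerD.
  rewrite mulr_sumr; apply: ler_sum => i _.
  by rewrite lift0 subSS exprS mulrA.
rewrite exprS invfM; apply: ler_wpM2l; first by rewrite invr_ge0.
rewrite big_ord_recl expr0 subn0 mul1r lerDl; apply: sumr_ge0 => i _.
by rewrite divr_ge0 ?exprn_ge0.
Qed.

Lemma laurent_majD m n : laurent_maj (n + m) <= (`|z| + `|z|^-1) ^+ m * laurent_maj n.
Proof.
elim: m => [|m IH]; first by rewrite addn0 mul1r.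
rewrite addnS; apply: le_trans (laurent_majS _) _.
by rewrite exprS -mulrA ler_wpM2l // addr_ge0 ?invr_ge0.
Qed.

Lemma laurent_majSS n : laurent_maj n.+2 = laurent_maj n + `|z| ^+ n.+2 + `|z| ^- n.+2.
Proof.
have nz0 : `|z| != 0 by rewrite normr_eq0.
rewrite {1}/laurent_maj big_ord_recl expr0 subn0 mul1r addrC; congr (_ + _).
rewrite big_ord_recr /= subnn expr0 divr1; congr (_ + _).
apply: eq_bigr => i _; have im : (i <= n)%N by rewrite -ltnS.
rewrite /bump /= add1n subSS subSn // !exprS.
by field; rewrite nz0 expf_neq0.
Qed.

Lemma qhermite_le :
  exists2 B : K, 0 <= B & forall n, `|qhermite q z n| <= B * laurent_maj n.
Proof.
have [A A0 pA] := pochn_bounded K_complete q_lt1 q.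
have [B B0 pB] := pochnV_bounded K_complete q_lt1 q_lt1.
exists (A * (B * B)) => [|n]; first by rewrite !mulr_ge0.
rewrite /qhermite normrM -mulrA; apply: ler_pM => //.
rewrite /rogers /laurent_maj mulr_sumr; apply: le_trans (ler_norm_sum _ _ _) _.
apply: ler_sum => i _; rewrite normrM [ `|_ / _|]normrM normfV !normrX.
apply: ler_wpM2r; first by rewrite divr_ge0 ?exprn_ge0.
by rewrite /rogers_coef !pochn_base0 !mul1r normrM ler_pM.
Qed.

(** Ratios of the three geometric series that control sum t^s H_(2s); the conditions persist under t
    -> t q^n. *)
Definition admissible (t : K) :=
  [/\ `|t| < 1, `|t * z ^+ 2| < 1 & `|t * z ^- 2| < 1].

Lemma admissible_mulXn t n : admissible t -> admissible (t * q ^+ n).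
Proof.
by case=> t1 t2 t3; split; rewrite 1?mulrAC; apply: norm_mulXn_lt1.
Qed.

(** By [laurent_majSS] the norms satisfy f(s+1) = |t| f(s) + |t z^2|^(s+1) + |t z^-2|^(s+1).
    Summation bounds 1 - |t| times the partial sum by 1 + A + B. *)
Lemma laurent_maj_summable t : admissible t ->
  abs_summable (fun s => t ^+ s * laurent_maj (2 * s)).
Proof.
case=> t1 t2 t3.
have [A A0 sA] := abs_summable_bound (abs_summable_geometric t2).
have [B B0 sB] := abs_summable_bound (abs_summable_geometric t3).
have t10 : 0 < 1 - `|t| by rewrite subr_gt0.
have nz0 : `|z| != 0 by rewrite normr_eq0.
pose f s := `|t ^+ s * laurent_maj (2 * s)|.
have fE s : f s = `|t| ^+ s * laurent_maj (2 * s).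
  by rewrite /f normrM normrX (ger0_norm (laurent_maj_ge0 _)).
have fS s : f s.+1 = `|t| * f s + `|(t * z ^+ 2) ^+ s.+1| + `|(t * z ^- 2) ^+ s.+1|.
  have -> : f s.+1 = `|t| ^+ s.+1 * laurent_maj (2 * s).+2.
    by rewrite fE; congr (_ * laurent_maj _); lia.
  rewrite laurent_majSS fE !normrX !normrM !normfV !normrX !exprMn exprVn -!exprM.
  have -> : (2 * s.+1 = (2 * s).+2)%N by lia.
  have -> : `|z| ^+ s.+1 * `|z| ^+ s.+1 = `|z| ^+ (2 * s).+2.
    by rewrite -exprD; congr (_ ^+ _); lia.
  by rewrite [ `|t| ^+ s.+1]exprS; ring.
have f0 : f 0%N = 1.
  by rewrite fE muln0 /laurent_maj big_ord1 subn0 !expr0 divr1 mulr1.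
exists ((1 + A + B) / (1 - `|t|)) => N.
rewrite -/(\sum_(n < N) f n) ler_pdivlMr // mulrBr mulr1 lerBlDr.
have f_ge0 s : 0 <= f s by apply: normr_ge0.
case: N => [|N]; first by rewrite big_ord0 mul0r addr0 !addr_ge0.
have -> : 1 + A + B + (\sum_(n < N.+1) f n) * `|t|
          = 1 + ((\sum_(n < N.+1) f n) * `|t| + A + B) by ring.
rewrite {1}big_ord_recl f0 lerD2l.
under eq_bigr do rewrite lift0 fS.
rewrite !big_split /= -mulr_sumr; apply: lerD; first apply: lerD.
- by rewrite mulrC; apply: ler_wpM2r => //; rewrite big_ord_recr lerDl.
- by apply: le_trans (sA N.+1); rewrite big_ord_recl lerDr.
- by apply: le_trans (sB N.+1); rewrite big_ord_recl lerDr.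
Qed.

(** Serves twice: it gives convergence of the generating sums, and it shows that the boundary terms
    of the telescoping sums tend to 0, being general terms of such series. *)
Lemma abs_summable_qhermite t m c : admissible t -> bounded_seq c ->
  abs_summable (fun s => c s * (t ^+ s * qhermite q z (2 * s + m))).
Proof.
move=> ht [C C0 cC]; have [B B0 hB] := qhermite_le.
pose Z := `|z| + `|z|^-1; have Z0 : 0 <= Z by rewrite addr_ge0 ?invr_ge0.
apply: abs_summable_le (laurent_maj_summable ht); last first.
  move=> s; rewrite (normrM (c s)) !(normrM (t ^+ s)) (ger0_norm (laurent_maj_ge0 _)).
  apply: (@le_trans _ _ (C * (`|t ^+ s| * (B * (Z ^+ m * laurent_maj (2 * s)))))).
    apply: ler_pM; [exact: normr_ge0|by apply: mulr_ge0; apply: normr_ge0|exact: cC|].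
    apply: ler_wpM2l => //; apply: le_trans (hB _) _.
    by apply: ler_wpM2l => //; apply: laurent_majD.
  have -> : C * (`|t ^+ s| * (B * (Z ^+ m * laurent_maj (2 * s))))
    = (C * B * Z ^+ m) * (`|t ^+ s| * laurent_maj (2 * s)) by ring.
  exact: lexx.
by rewrite !mulr_ge0 ?exprn_ge0.
Qed.

Lemma bounded_seq_pochnqV j : bounded_seq (fun s => (pochn q q (s + j))^-1).
Proof.
have [B B0 pB] := pochnV_bounded K_complete q_lt1 q_lt1.
by exists B.
Qed.

Lemma bounded_seq_qpochinf t j : `|t| < 1 ->
  bounded_seq (fun s => qpochinf (t * q ^+ (s + j)) q).
Proof.
move=> t1; have [B B0 pB] := qpochinf_tail_bounded K_complete q_lt1 t1.
by exists B.
Qed.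

(** * The generating sums: recurrence in m and q-difference equation in t *)

Definition gen_coef t m s : K :=
  t ^+ s * qpochinf (t * q ^+ (s + m).+1) q / pochn q q s.

(** Left side of the conjugate Bailey pair. *)
Definition gen_sum t m : K :=
  limn (series (fun s => gen_coef t m s * qhermite q z (2 * s + m))).

Lemma gen_sum_summable t m : admissible t ->
  abs_summable (fun s => gen_coef t m s * qhermite q z (2 * s + m)).
Proof.
move=> ht; have [t1 _ _] := ht.
have := @abs_summable_qhermite t m
  (fun s => qpochinf (t * q ^+ (s + m.+1)) q * (pochn q q (s + 0))^-1) ht.
have -> : (fun s => gen_coef t m s * qhermite q z (2 * s + m))
   = (fun s => qpochinf (t * q ^+ (s + m.+1)) q / pochn q q (s + 0)
               * (t ^+ s * qhermite q z (2 * s + m))).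
  by apply/funext => s; rewrite /gen_coef addn0 addnS; ring.
apply; apply: bounded_seqM; first exact: bounded_seq_qpochinf.
exact: bounded_seq_pochnqV.
Qed.

Lemma gen_sumP t m : admissible t ->
  has_sum (fun s => gen_coef t m s * qhermite q z (2 * s + m)) (gen_sum t m).
Proof. by move=> ht; exact: (K_complete (gen_sum_summable m ht)). Qed.

Lemma qpochinfS t s :
  qpochinf (t * q ^+ s) q = (1 - t * q ^+ s) * qpochinf (t * q ^+ s.+1) q.
Proof.
rewrite (qpochinf_split K_complete q_lt1 _ 1) pochnS pochn0 mul1r expr0 mulr1.
by rewrite expr1 -mulrA -exprSr.
Qed.

(** Limit of [telescope_rec0], whose boundary term is a bounded sequence times t^s H_(2s+1). The
    next two lemmas follow the same scheme. *)
Lemma gen_sum_rec0 t : admissible t ->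
  (z + z^-1) * (1 - t) * gen_sum t 0 = (1 - t ^+ 2) * gen_sum t 1.
Proof.
move=> ht; have [t1 _ _] := ht; apply/eqP; rewrite -subr_eq0; apply/eqP.
have s1 := has_sumB (has_sumZ ((z + z^-1) * (1 - t)) (@gen_sumP _ 0 ht))
                    (has_sumZ (1 - t ^+ 2) (@gen_sumP _ 1 ht)).
(* The boundary term with t^s H_(2s+1) taken out; the extra factor t comes from t^(s+1). *)
pose c s := - ((1 - t) * (1 - q ^+ (2 * s.+1)) * t * qpochinf (t * q ^+ (s + 2)) q
               * (pochn q q (s + 1))^-1).
have c0 : (fun s => c s * (t ^+ s * qhermite q z (2 * s + 1))) @ \oo --> 0.
  apply: abs_summable_cvg0 => //; apply: abs_summable_qhermite => //.
  rewrite /c; under eq_fun do rewrite -[- _]sub0r; apply: bounded_seqB.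
    exact: bounded_seq_cst.
  apply: bounded_seqM; last exact: bounded_seq_pochnqV.
  apply: bounded_seqM; last exact: bounded_seq_qpochinf.
  apply: bounded_seqM; last exact: bounded_seq_cst.
  apply: bounded_seqM; first exact: bounded_seq_cst.
  apply: bounded_seqB; first exact: bounded_seq_cst.
  exact: bounded_seqX.
(* The telescoped identity has N + 1 terms, hence the shift of the partial sums. *)
move: s1; rewrite /has_sum -cvg_shiftS => s1.
apply: (cvgn_unique s1); apply: (eq_cvgn _ c0) => N; rewrite /series /= big_mkord.
have := telescope_rec0 q_nroot z_neq0 (qpochinfS t) N.
rewrite /gen_coef => T.
transitivity (- ((1 - t) * (1 - q ^+ (2 * N.+1)) * (t ^+ N.+1
  * qpochinf (t * q ^+ (N.+1 + 0).+1) q / pochn q q N.+1) * qhermite q z (2 * N).+1)).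
  by rewrite /c !addn0 !addn1 addn2 [t ^+ N.+1]exprS; ring.
rewrite -T; apply: eq_bigr => s _; rewrite !addn0 !addn1.
by ring.
Qed.

Lemma gen_sum_recS t m : admissible t ->
  (z + z^-1) * (1 - t * q ^+ m.+1) * gen_sum t m.+1
  = (1 - t ^+ 2 * q ^+ m.+1) * gen_sum t m.+2 + (1 - q ^+ m.+1) * gen_sum t m.
Proof.
move=> ht; have [t1 _ _] := ht; apply/eqP; rewrite -subr_eq0 opprD addrA; apply/eqP.
have s1 := has_sumB (has_sumB
     (has_sumZ ((z + z^-1) * (1 - t * q ^+ m.+1)) (@gen_sumP _ m.+1 ht))
     (has_sumZ (1 - t ^+ 2 * q ^+ m.+1) (@gen_sumP _ m.+2 ht)))
     (has_sumZ (1 - q ^+ m.+1) (@gen_sumP _ m ht)).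
pose c s := ((1 - q ^+ m.+1) * qpochinf (t * q ^+ (s + m.+1)) q
     - (1 - t * q ^+ m.+1) * (1 - q ^+ (2 * s + m).+1)
       * qpochinf (t * q ^+ (s + m.+2)) q) * (pochn q q (s + 0))^-1.
have c0 : (fun s => c s * (t ^+ s * qhermite q z (2 * s + m))) @ \oo --> 0.
  apply: abs_summable_cvg0 => //; apply: abs_summable_qhermite => //.
  apply: bounded_seqM; last exact: bounded_seq_pochnqV.
  apply: bounded_seqB.
    apply: bounded_seqM; last exact: bounded_seq_qpochinf.
    exact: bounded_seq_cst.
  apply: bounded_seqM; last exact: bounded_seq_qpochinf.
  apply: bounded_seqM; first exact: bounded_seq_cst.
  apply: bounded_seqB; first exact: bounded_seq_cst.
  exact: bounded_seqX.
apply: (cvgn_unique s1); apply: (eq_cvgn _ c0) => N; rewrite /series /= big_mkord.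
have := telescope_recS q_nroot z_neq0 (qpochinfS t) m N.
rewrite /gen_coef => T.
under [RHS]eq_bigr do rewrite !addnS.
transitivity (((1 - q ^+ m.+1) * (t ^+ N * qpochinf (t * q ^+ (N + m).+1) q / pochn q q N)
  - (1 - t * q ^+ m.+1) * (1 - q ^+ (2 * N + m).+1)
    * (t ^+ N * qpochinf (t * q ^+ (N + m.+1).+1) q / pochn q q N))
  * qhermite q z (2 * N + m)).
  by rewrite /c !addn0 !addnS; ring.
rewrite -T; apply: eq_bigr => s _; rewrite !addnS.
by ring.
Qed.

Lemma gen_sum_fun t : admissible t ->
  (1 - t * z ^+ 2) * (1 - t * z ^- 2) * gen_sum t 0
  = (1 + t) * (1 - t ^+ 2 * q) * gen_sum (t * q) 0.
Proof.
move=> ht; have [t1 _ _] := ht; apply/eqP; rewrite -subr_eq0; apply/eqP.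
have htq : admissible (t * q) by rewrite -[q]expr1; apply: admissible_mulXn.
have s1 := has_sumB
     (has_sumZ ((1 - t * z ^+ 2) * (1 - t * z ^- 2)) (@gen_sumP _ 0 ht))
     (has_sumZ ((1 + t) * (1 - t ^+ 2 * q)) (@gen_sumP _ 0 htq)).
pose c s := t * (1 - q ^+ (2 * s).+2) * (1 - q ^+ (2 * s).+1) * t
   * qpochinf (t * q ^+ (s + 2)) q * (pochn q q (s + 1))^-1.
pose c' s := t * qpochinf (t * q ^+ (s + 1)) q * (pochn q q (s + 0))^-1.
have c0 : (fun s => c s * (t ^+ s * qhermite q z (2 * s + 0))
                    - c' s * (t ^+ s * qhermite q z (2 * s + 2))) @ \oo --> 0 - 0.
  apply: cvgB; (apply: abs_summable_cvg0 => //; apply: abs_summable_qhermite => //).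
    apply: bounded_seqM; last exact: bounded_seq_pochnqV.
    apply: bounded_seqM; last exact: bounded_seq_qpochinf.
    apply: bounded_seqM; last exact: bounded_seq_cst.
    apply: bounded_seqM; last first.
      by apply: bounded_seqB; [exact: bounded_seq_cst|exact: bounded_seqX].
    apply: bounded_seqM; first exact: bounded_seq_cst.
    by apply: bounded_seqB; [exact: bounded_seq_cst|exact: bounded_seqX].
  apply: bounded_seqM; last exact: bounded_seq_pochnqV.
  apply: bounded_seqM; last exact: bounded_seq_qpochinf.
  exact: bounded_seq_cst.
move: s1; rewrite /has_sum -cvg_shiftS => s1.
rewrite subr0 in c0; apply: (cvgn_unique s1).
apply: (eq_cvgn _ c0) => N; rewrite /series /= big_mkord.
have := telescope_fun q_nroot z_neq0 (qpochinfS t) N.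
rewrite /gen_coef => T.
transitivity (t * (1 - q ^+ (2 * N).+2) * (1 - q ^+ (2 * N).+1)
   * (t ^+ N.+1 * qpochinf (t * q ^+ (N.+1 + 0).+1) q / pochn q q N.+1)
   * qhermite q z (2 * N)
   - t * (t ^+ N * qpochinf (t * q ^+ (N + 0).+1) q / pochn q q N)
     * qhermite q z (2 * N).+2).
  by rewrite /c /c' !addn0 !addn1 !addn2 [t ^+ N.+1]exprS; ring.
rewrite -T; apply: eq_bigr => s _; rewrite !addn0 !addn1.
have -> : t * q * q ^+ s.+1 = t * q ^+ s.+2 by rewrite -mulrA -exprS.
by rewrite exprMn; ring.
Qed.

(** The term s = 0 is (t q^(n+1); q)_oo, which tends to 1. Every other term contains (q^n)^s with s
    >= 1, so together they are at most |q|^n times a constant. *)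
Lemma gen_sum_cvg1 t : admissible t ->
  (fun n => gen_sum (t * q ^+ n) 0) @ \oo --> (1 : K).
Proof.
move=> ht; have [t1 _ _] := ht.
have [A A0 hA] := bounded_seq_qpochinf 0 t1.
have [B B0 pB] := bounded_seq_pochnqV 0.
have [W W0 sW] := abs_summable_bound (abs_summable_qhermite 0 ht (bounded_seq_cst (A * B))).
have AB : `|A * B| = A * B by rewrite ger0_norm // mulr_ge0.
have bnd n : `|gen_sum (t * q ^+ n) 0 - qpochinf (t * q ^+ n.+1) q| <= `|q| ^+ n * W.
  have htn := admissible_mulXn n ht.
  pose v s := gen_coef (t * q ^+ n) 0 s * qhermite q z (2 * s + 0).
  (* The bound is claimed from N = 1 on, so that the term s = 0 can be split off. *)
  apply: (@cvg_norm_le _ (fun N => series v N - qpochinf (t * q ^+ n.+1) q) _ _ 1).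
    by apply: cvgB; [exact: gen_sumP|exact: cvg_cst].
  case=> // N _; rewrite /series /= big_mkord big_ord_recl.
  have -> : v 0%N = qpochinf (t * q ^+ n.+1) q.
    rewrite /v /gen_coef !muln0 !addn0 qhermite0 expr0 pochn0 divr1 mulr1 mul1r.
    by rewrite expr1 -mulrA -exprSr.
  rewrite addrAC subrr add0r; apply: le_trans (ler_norm_sum _ _ _) _.
  apply: le_trans (_ : \sum_(i < N) `|q| ^+ n
    * `|A * B * (t ^+ i.+1 * qhermite q z (2 * i.+1 + 0))| <= _); last first.
    rewrite -mulr_sumr; apply: ler_wpM2l; first exact: exprn_ge0.
    apply: le_trans (sW N.+1); rewrite [leRHS]big_ord_recl.
    have -> : \sum_(i < N) `|A * B * (t ^+ i.+1 * qhermite q z (2 * i.+1 + 0))|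
      = \sum_(i < N) `|A * B * (t ^+ (lift ord0 i) * qhermite q z (2 * (lift ord0 i) + 0))|.
      by apply: eq_bigr => i _; rewrite lift0.
    by rewrite lerDr.
  apply: ler_sum => i _; rewrite lift0 /v /gen_coef; set j := i.+1.
  have -> : (t * q ^+ n) ^+ j * qpochinf (t * q ^+ n * q ^+ (j + 0).+1) q / pochn q q j
     * qhermite q z (2 * j + 0)
    = (q ^+ n) ^+ j * (qpochinf (t * q ^+ (n + j.+1 + 0)) q * (pochn q q (j + 0))^-1
      * (t ^+ j * qhermite q z (2 * j + 0))).
    by rewrite !addn0 exprMn -[t * q ^+ n * _]mulrA -exprD; ring.
  rewrite (normrM (_ ^+ j)); apply: ler_pM => //.
    rewrite normrX normrX -exprM mulnS exprD ler_piMr ?exprn_ge0 //.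
    by rewrite exprn_ile1 // ltW.
  rewrite (normrM (_ / _)) (normrM (A * B)) AB; apply: ler_wpM2r => //.
  by rewrite normrM; apply: ler_pM.
have q0 : (fun n => q ^+ n) @ \oo --> (0 : K).
  by apply: abs_summable_cvg0 => //; apply: abs_summable_geometric.
have h1 : (fun n => qpochinf (t * q ^+ n.+1) q) @ \oo --> (1 : K).
  have := qpochinf_tail K_complete q_lt1 t1.
  by rewrite -(cvg_shiftS (fun n => qpochinf (t * q ^+ n) q)).
have d0 : (fun n => gen_sum (t * q ^+ n) 0 - qpochinf (t * q ^+ n.+1) q) @ \oo --> (0 : K).
  apply/cvgr0Pnorm_le => e e0.
  have W1 : 0 < W + 1 by rewrite ltr_wpDl.
  have /cvgr0Pnorm_le /(_ _ (divr_gt0 e0 W1)) [N _ qN] := q0.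
  exists N => // n Nn; apply: le_trans (bnd n) _.
  have := qN n Nn; rewrite normrX ler_pdivlMr // => qW.
  apply: le_trans qW; apply: ler_wpM2l; first exact: exprn_ge0.
  by rewrite lerDl.
have d1 := cvgD d0 h1; rewrite add0r in d1; apply: (eq_cvgn _ (d1 _)) => n.
exact: subrK.
Qed.

(** * Closed form of the generating sums *)

Definition gen_den t : K :=
  qpochinf t q * qpochinf (t * z ^+ 2) q * qpochinf (t * z ^- 2) q.

Lemma gen_den_neq0 t : admissible t -> gen_den t != 0.
Proof. by case=> t1 t2 t3; rewrite !mulf_neq0 // qpochinf_neq0. Qed.

(** Iterates [gen_sum_fun]. With u = t q^n, each step produces (1 - u)(1 + u)(1 - u^2 q) = (1 -
    u^2)(1 - u^2 q), the next two factors of (t^2; q)_oo. *)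
Lemma gen_sum_shift t n : admissible t ->
  gen_den t * gen_sum t 0
  = pochn (t ^+ 2) q (2 * n) * (gen_den (t * q ^+ n) * gen_sum (t * q ^+ n) 0).
Proof.
move=> ht; elim: n => [|n IH].
  by rewrite muln0 pochn0 mul1r expr0 mulr1.
rewrite IH; have -> : (2 * n.+1 = (2 * n).+2)%N by lia.
set u := t * q ^+ n; have hu : admissible u by exact: admissible_mulXn.
have -> : t * q ^+ n.+1 = u * q by rewrite exprSr mulrA.
have fu := gen_sum_fun hu.
have dS (a : K) : qpochinf a q = (1 - a) * qpochinf (a * q) q.
  by have := qpochinfS a 0; rewrite expr0 mulr1 expr1.
rewrite !pochnS.
have -> : t ^+ 2 * q ^+ (2 * n) = u ^+ 2.
  by rewrite /u exprMn -exprM mulnC.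
have -> : t ^+ 2 * q ^+ (2 * n).+1 = u ^+ 2 * q.
  by rewrite /u exprMn -exprM mulnC [q ^+ _.+1]exprSr mulrA.
rewrite {1}/gen_den (dS u) (dS (u * z ^+ 2)) (dS (u * z ^- 2)) /gen_den.
transitivity (pochn (t ^+ 2) q (2 * n) * (1 - u) * qpochinf (u * q) q
   * qpochinf (u * z ^+ 2 * q) q
   * qpochinf (u * z ^- 2 * q) q
   * ((1 - u * z ^+ 2) * (1 - u * z ^- 2) * gen_sum u 0)); first by ring.
by rewrite fu ![u * q * _]mulrAC; ring.
Qed.

Lemma gen_sum0 t : admissible t -> gen_den t * gen_sum t 0 = qpochinf (t ^+ 2) q.
Proof.
move=> ht; have [t1 t2 t3] := ht.
have c1 : (fun n => pochn (t ^+ 2) q (2 * n)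
               * (gen_den (t * q ^+ n) * gen_sum (t * q ^+ n) 0))
     @ \oo --> qpochinf (t ^+ 2) q * (1 * 1 * 1 * 1).
  apply: cvgM.
    have /cvgrPdist_lt pc := @pochn_cvg _ K_complete _ q_lt1 (t ^+ 2).
    apply/cvgrPdist_lt => e /pc [N _ hN]; exists N => // n /= Nn.
    by apply: hN => /=; lia.
  apply: cvgM; last exact: gen_sum_cvg1.
  apply: cvgM; first apply: cvgM.
  - exact: qpochinf_tail.
  - by under eq_fun do rewrite mulrAC; exact: qpochinf_tail.
  - by under eq_fun do rewrite mulrAC; exact: qpochinf_tail.
have c2 : (fun n => pochn (t ^+ 2) q (2 * n)
               * (gen_den (t * q ^+ n) * gen_sum (t * q ^+ n) 0))
     @ \oo --> gen_den t * gen_sum t 0.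
  under eq_fun do rewrite -gen_sum_shift //.
  exact: cvg_cst.
by rewrite (cvgn_unique c2 c1) !mulr1.
Qed.

Lemma sqr_lt1 (t : K) : `|t| < 1 -> `|t ^+ 2| < 1.
Proof. by move=> t1; rewrite normrX exprn_ilt1. Qed.

(** The conjugate Bailey pair, by strong induction with the common three-term recurrence, after
    cancelling its leading coefficient 1 - t^2 q^(m+1). All m are covered because the recurrence
    links both parities. *)
Lemma gen_sumE t m : admissible t ->
  gen_den t * gen_sum t m
  = pochn q q m * qpochinf (t ^+ 2 * q ^+ m) q * rogers q t z m.
Proof.
move=> ht; have [t1 _ _] := ht; have nr := q_nroot.
have nt n : 1 - t ^+ 2 * q ^+ n != 0.
  by apply/one_sub_neq0/norm_mulXn_lt1 => //; exact: sqr_lt1.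
have hS := qpochinfS (t ^+ 2).
elim/ltn_ind: m => [[|[|m]]] IH.
- by rewrite gen_sum0 // rogers0 pochn0 expr0 mulr1 mul1r mulr1.
- apply: (mulfI (nt 0%N)); rewrite expr0 mulr1.
  rewrite mulrCA -gen_sum_rec0 // mulrCA gen_sum0 //.
  have := hS 0%N; rewrite expr0 mulr1 => ->.
  have := rogers1 nr t z_neq0 => e1.
  rewrite pochnS pochn0 expr0 mulr1 mul1r.
  transitivity ((1 - t ^+ 2) * qpochinf (t ^+ 2 * q ^+ 1) q * ((z + z^-1) * (1 - t))).
    by ring.
  by rewrite -e1; ring.
have IH1 := IH m.+1 (ltnSn _); have IH0 := IH m (leqnSn _).
have r := gen_sum_recS m ht.
have C2 := rogersSS nr t m z_neq0.
apply: (mulfI (nt m.+1)).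
transitivity (gen_den t * ((1 - t ^+ 2 * q ^+ m.+1) * gen_sum t m.+2
   + (1 - q ^+ m.+1) * gen_sum t m) - (1 - q ^+ m.+1) * (gen_den t * gen_sum t m)).
  by ring.
rewrite -r IH0.
transitivity ((z + z^-1) * (1 - t * q ^+ m.+1) * (gen_den t * gen_sum t m.+1)
   - (1 - q ^+ m.+1)
     * (pochn q q m * qpochinf (t ^+ 2 * q ^+ m) q * rogers q t z m)).
  by ring.
rewrite IH1 [pochn q q m.+2]pochnS -exprS.
transitivity ((1 - t ^+ 2 * q ^+ m.+1) * pochn q q m.+1
  * qpochinf (t ^+ 2 * q ^+ m.+2) q * ((1 - q ^+ m.+2) * rogers q t z m.+2)); last by ring.
rewrite C2 pochnS -exprS (hS m) (hS m.+1).
by ring.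
Qed.

End Hermite.

(** * Sums over chains *)

#[local] Existing Instance totally_filter.

(** * Unordered sums over an index set graded into finite levels *)

Section Unordered.
Variable K : numFieldType.
Hypothesis K_complete : forall u : nat -> K, abs_summable u -> cvgn (series u).

Lemma big_height (J : eqType) (h : J -> nat) (F : J -> K) (B : seq J) M :
  (forall j, j \in B -> (h j < M)%N) ->
  \sum_(j <- B) F j = \sum_(n < M) \sum_(j <- B | h j == n) F j.
Proof.
move=> BM; under [RHS]eq_bigr do rewrite big_mkcond.
rewrite exchange_big /=; apply: eq_big_seq => j jB.
rewrite -big_mkcond /=.
rewrite (big_pred1 (Ordinal (BM j jB))) // => i /=.
Qed.

(** The index type is embedded by [v] into a simpler type, where [A n] lists the elements of height
    n. A finite set containing all levels below N differs from the Nth partial sum only by terms of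
    height at least N, bounded by a tail of d. *)
Lemma multisum_height (I : choiceType) (J : choiceType) (v : I -> J)
    (inv : J -> option I) (h : J -> nat) (A : nat -> seq J) (S : pred J)
    (F : J -> K) (d : nat -> K) (l : K) :
  pcancel v inv -> (forall i, S (v i)) -> (forall j, S j -> exists i, v i = j) ->
  (forall n, uniq (A n)) -> (forall n j, (j \in A n) = S j && (h j == n)) ->
  (forall n, \sum_(j <- A n) `|F j| <= d n) -> abs_summable d ->
  has_sum (fun n => \sum_(j <- A n) F j) l ->
  partial_sum (fun i => F (v i)) @ totally --> l.
Proof.
move=> vK Sv SvE uA memA Fd sd Fl; have v_inj := pcan_inj vK.
apply/cvgrPdist_le => e e0; have e2 : 0 < e / 2 by rewrite divr_gt0.
have [N1 tl] := abs_summable_tail K_complete sd e2.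
have /cvgrPdist_le /(_ _ e2) [N2 _ sN] := Fl.
pose N := maxn N1 N2.
pose B0 := [fset i in pmap inv (flatten [seq A n | n <- iota 0 N])]%fset.
exists B0 => //= B B0B.
have -> : partial_sum (fun i => F (v i)) B = \sum_(j <- [seq v i | i <- enum_fset B]) F j.
  by rewrite big_map big_seq_fsetE.
set L := [seq v i | i <- enum_fset B].
have uL : uniq L by rewrite map_inj_uniq // fset_uniq.
have SL j : j \in L -> S j by case/mapP => i _ ->.
(* Since B contains [B0], its part at each height below N is the full level. *)
have AL n : (n < N)%N -> perm_eq [seq j <- L | h j == n] (A n).
  move=> nN; apply: uniq_perm; rewrite ?filter_uniq // => j.
  rewrite mem_filter memA; case hj: (h j == n); rewrite ?andbT ?andbF //=.
  apply/idP/idP => [/SL //|Sj]; have [i vi] := SvE _ Sj.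
  rewrite -vi; apply: map_f; apply: (fsubsetP B0B).
  rewrite in_fset /= mem_pmap -vK; apply: map_f; apply/flattenP.
  exists (A n); first by apply: map_f; rewrite mem_iota.
  by rewrite vi memA Sj.
pose M := (N + (\max_(j <- L) h j).+1)%N.
have LM j : j \in L -> (h j < M)%N.
  move=> jL; rewrite /M addnS ltnS; apply: leq_trans (leq_addl _ _).
  exact: leq_bigmax_seq.
have part n : (n < N)%N -> \sum_(j <- L | h j == n) F j = \sum_(j <- A n) F j.
  by move=> nN; rewrite -big_filter; apply: perm_big; apply: AL.
rewrite (big_height F LM) -(big_mkord xpredT (fun n => \sum_(j <- L | h j == n) F j)).
rewrite (@big_cat_nat _ _ _ N) //=; last by rewrite /M leq_addr.
have -> : \sum_(0 <= n < N) \sum_(j <- L | h j == n) F j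
          = series (fun n => \sum_(j <- A n) F j) N.
  by rewrite /series /=; apply: eq_big_nat => n /andP[_ /part].
rewrite opprD addrA; apply: le_trans (ler_normB _ _) _.
rewrite [leRHS](splitr e); apply: lerD.
  by apply: sN; rewrite /= /N leq_maxr.
apply: le_trans (ler_norm_sum _ _ _) _.
apply: le_trans (tl N M _); last by rewrite /N leq_maxl.
apply: ler_sum => n _; apply: le_trans (ler_norm_sum _ _ _) _.
have dn : d n <= `|d n|.
  apply: real_ler_norm; apply: ger0_real; apply: le_trans (Fd n).
  exact: sumr_ge0.
apply: le_trans dn; apply: le_trans (Fd n).
rewrite -big_filter.
(* From height N on, B meets a level only in a subset; the missing norms are nonnegative. *)
have pe : perm_eq [seq j <- L | h j == n] [seq j <- A n | j \in L].
  apply: uniq_perm; rewrite ?filter_uniq // => j; rewrite !mem_filter memA.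
  case jL: (j \in L); rewrite ?andbF //= andbT.
  by rewrite (SL _ jL).
rewrite (perm_big _ pe) big_filter [leRHS](bigID (fun j => j \in L)) /= lerDl.
exact: sumr_ge0.
Qed.

End Unordered.

(* The members have length k.+1, not k. *)
Fixpoint chains k n : seq (seq nat) :=
  if k is k'.+1 then
    flatten [seq [seq rcons s n | s <- chains k' r] | r <- iota 0 n.+1]
  else [:: [:: n]].

Lemma chainsS k n :
  chains k.+1 n = flatten [seq [seq rcons s n | s <- chains k r] | r <- iota 0 n.+1].
Proof. by []. Qed.

Lemma sorted_rcons_leq s n : (0 < size s)%N ->
  sorted leq (rcons s n) = sorted leq s && (last 0%N s <= n)%N.
Proof. by case: s => //= x s _; rewrite rcons_path. Qed.

Lemma mem_chains k n s :
  (s \in chains k n) = [&& size s == k.+1, sorted leq s & last 0%N s == n].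
Proof.
elim: k n s => [|k IH] n s.
  rewrite /= inE; case: s => [|x [|y s]] //=.
  - by rewrite eqseq_cons andbT.
  - by rewrite eqseq_cons andbF.
rewrite chainsS; apply/flattenP/idP.
  case=> l /mapP[r]; rewrite mem_iota => /andP[_ rn] -> /mapP[s'].
  rewrite IH => /and3P[/eqP ss' sos' /eqP ls'] ->.
  rewrite size_rcons ss' eqxx last_rcons eqxx andbT /= sorted_rcons_leq ?ss' //.
  by rewrite sos' ls' -ltnS.
case/and3P; case/lastP: s => // s' x; rewrite size_rcons eqSS => /eqP ss'.
rewrite sorted_rcons_leq ?ss' // => /andP[sos' lx]; rewrite last_rcons => /eqP xn.
exists [seq rcons s n | s <- chains k (last 0%N s')].
  by apply/mapP; exists (last 0%N s') => //; rewrite mem_iota add0n ltnS -xn.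
by rewrite -xn; apply: map_f; rewrite IH ss' sos' !eqxx.
Qed.

Lemma sum_chains (V : nmodType) k n (f : seq nat -> V) :
  \sum_(s <- chains k.+1 n) f s
  = \sum_(r < n.+1) \sum_(s <- chains k r) f (rcons s n).
Proof.
rewrite chainsS.
rewrite big_flatten big_map -[iota 0 n.+1]/(index_iota 0 n.+1) big_mkord.
by apply: eq_bigr => r _; rewrite big_map.
Qed.

Lemma uniq_chains k n : uniq (chains k n).
Proof.
elim: k n => [|k IH] n //.
have Ps r : {in chains k r, forall s, last 0%N s = r}.
  by move=> s; rewrite mem_chains => /and3P[_ _ /eqP].
rewrite chainsS.
elim: (iota 0 n.+1) (iota_uniq 0 n.+1) => //= r l IHl /andP[rl ul].
rewrite cat_uniq IHl // andbT map_inj_uniq; last exact: rcons_injl.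
rewrite IH /=; apply/hasPn => s /flattenP[_ /mapP[r' r'l ->] /mapP[s' s'r' ->]].
apply/mapP => -[s'' s''r E0]; have E : s' = s'' by exact: rcons_injl E0.
have e'' : last 0%N s'' = r by exact: Ps.
have e' : last 0%N s' = r' by exact: Ps.
by move: rl; rewrite -e'' -E e' r'l.
Qed.

(** * Weights of chains and the iterated Bailey beta *)

Section ChainWeight.
Variables (F : fieldType) (q t : F).

(** The summand of the left side without its inner sum over j, for chains of length k + 1. *)
Definition chain_weight k (s : seq nat) : F :=
  t ^+ (\sum_(i < k.+1) nth 0%N s i) * q ^+ (\sum_(i < k) nth 0%N s i ^ 2)
  / ((\prod_(i < k) pochn q q (nth 0%N s i.+1 - nth 0%N s i)) * pochn q q (nth 0%N s 0)).

Lemma chain_weight_rcons k s n : size s = k.+1 ->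
  chain_weight k.+1 (rcons s n)
  = chain_weight k s * (t ^+ n * q ^+ (last 0%N s ^ 2) / pochn q q (n - last 0%N s)).
Proof.
move=> ss; have nthl i : (i < k.+1)%N -> nth 0%N (rcons s n) i = nth 0%N s i.
  by move=> ik; rewrite nth_rcons ss ik.
have nthn : nth 0%N (rcons s n) k.+1 = n by rewrite nth_rcons ss ltnn eqxx.
have lastE : last 0%N s = nth 0%N s k by rewrite -nth_last ss.
rewrite /chain_weight big_ord_recr /= nthn.
rewrite [(\sum_(i < k.+1) nth 0%N (rcons s n) i ^ 2)%N]big_ord_recr /=.
rewrite [\prod_(i < k.+1) _]big_ord_recr /= nthn !nthl // -lastE.
under eq_bigr => i _ do rewrite nthl //.
under [in q ^+ _]eq_bigr => i _ do rewrite nthl ?(ltn_trans (ltn_ord i)) //.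
under [in \prod_(_ < _) _]eq_bigr => i _ do
  rewrite (nthl i.+1) ?ltnS // (nthl i) ?(ltn_trans (ltn_ord i)) //.
rewrite !exprD !invfM; ring.
Qed.

(** Appending an entry to a chain is one Bailey step. The last entry has no factor q^(n^2); it
    acquires one only when the next entry is appended, which matches the exponents of the
    theorem. *)
Lemma sum_chain_weight k n :
  \sum_(s <- chains k n) chain_weight k s = t ^+ n * bailey_beta q t k.+1 n.
Proof.
elim: k n => [|k IH] n.
  rewrite /= big_seq1 /chain_weight big_ord1 !big_ord0 /= expr0 mulr1 mul1r.
  (* Only s = 0 survives in the first level over the unit pair, leaving 1/(q)_n. *)
  congr (_ * _); rewrite big_ord_recl /= expr0 subn0 !mul1r mulr1.
  by rewrite big1 ?addr0 // => i _; rewrite mulr0.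
rewrite sum_chains [bailey_beta _ _ _ _]/= mulr_sumr; apply: eq_bigr => r _.
rewrite -/(bailey_beta q t k.+1 r).
transitivity (\sum_(s <- chains k r)
   chain_weight k s * (t ^+ n * q ^+ (r ^ 2) / pochn q q (n - r))).
  apply: eq_big_seq => s; rewrite mem_chains => /and3P[/eqP ss _ /eqP ls].
  by rewrite chain_weight_rcons // ls.
rewrite -mulr_suml IH; ring.
Qed.

End ChainWeight.

(** * Assembly of the identity *)

Section Main.
Variable K : numFieldType.
Hypothesis K_complete : forall u : nat -> K, abs_summable u -> cvgn (series u).
Variables q t z : K.
Hypothesis q_lt1 : `|q| < 1.
Hypothesis z_neq0 : z != 0.
Hypothesis t_adm : admissible z t.

(** Domination for the multiple sum: an appended entry n costs at most B |t|^n, and the sum over the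
    previous entry r converges because of |t|^r. *)
Lemma sum_norm_chain_weight k : exists2 C : K, 0 <= C &
  forall n, \sum_(s <- chains k n) `|chain_weight q t k s| <= C * `|t| ^+ n.
Proof.
have [t1 _ _] := t_adm.
have [B B0 pB] := pochnV_bounded K_complete q_lt1 q_lt1.
have [T T0 sT] := abs_summable_bound (abs_summable_geometric t1).
elim: k => [|k [C C0 IH]].
  exists B => // n; rewrite /= big_seq1 /chain_weight big_ord1 !big_ord0 /=.
  by rewrite expr0 mulr1 mul1r normrM normrX mulrC ler_wpM2r ?exprn_ge0.
exists (C * B * T) => [|n]; first by rewrite !mulr_ge0.
rewrite sum_chains.
apply: le_trans (_ : \sum_(r < n.+1) C * B * `|t| ^+ n * `|t ^+ r| <= _); last first.
  rewrite -mulr_sumr [leRHS]mulrAC; apply: ler_wpM2l => //.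
  by rewrite !mulr_ge0 ?exprn_ge0.
apply: ler_sum => r _.
have -> : \sum_(s <- chains k r) `|chain_weight q t k.+1 (rcons s n)|
  = \sum_(s <- chains k r) `|chain_weight q t k s|
      * `|t ^+ n * q ^+ (r ^ 2) / pochn q q (n - r)|.
  apply: eq_big_seq => s; rewrite mem_chains => /and3P[/eqP ss _ /eqP ls].
  by rewrite chain_weight_rcons // ls normrM.
rewrite -mulr_suml.
apply: le_trans (_ : C * `|t| ^+ r * (`|t| ^+ n * 1 * B) <= _); last first.
  by rewrite normrX le_eqVlt; apply/orP; left; apply/eqP; ring.
apply: ler_pM => //; first exact: sumr_ge0.
rewrite !normrM !normrX; apply: ler_pM => //; first by rewrite mulr_ge0 ?exprn_ge0.
apply: ler_wpM2l; first exact: exprn_ge0.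
by rewrite exprn_ile1 // ltW.
Qed.

Lemma exprz_laurent (j m : nat) : (j <= 2 * m)%N ->
  z ^ ((2 * j)%N%:Z - (2 * m)%N%:Z) = z ^+ j / z ^+ (2 * m - j).
Proof.
move=> jm; rewrite expfzDr // -invr_expz -!exprnP.
apply/eqP; rewrite eqr_div ?expf_neq0 // -!exprD.
by apply/eqP; congr (_ ^+ _); lia.
Qed.

Lemma sum_qbinom m :
  \sum_(j < (2 * m).+1) qbinom q (2 * m) j * z ^ ((2 * j)%N%:Z - (2 * m)%N%:Z)
  = qhermite q z (2 * m).
Proof.
rewrite /qhermite /rogers mulr_sumr; apply: eq_bigr => j _.
have jm : (j <= 2 * m)%N by rewrite -ltnS.
rewrite exprz_laurent // /qbinom jm !qpochE // /rogers_coef.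
by rewrite !pochn_base0 !mul1r invfM; ring.
Qed.

Lemma lhs_termE k (n : chain k.+1) :
  lhs_term q t z n = chain_weight q t k (tval (val n))
                     * qhermite q z (2 * last 0%N (tval (val n))).
Proof.
rewrite /lhs_term /= sum_qbinom /chain_weight -nth_last size_tuple /=.
congr (_ * _ / (_ * _) * _); rewrite ?qpochE //.
by apply: eq_bigr => i _; rewrite qpochE.
Qed.

Definition bailey_alpha k r : K := (t ^+ r * q ^+ (r ^ 2)) ^+ k * unit_alpha q t r.

(** One factor t^r gives the geometric decay and all the rest is bounded; this is where at least one
    Bailey step enters. *)
Lemma bailey_alpha_le k :
  exists2 A : K, 0 <= A & forall r, `|bailey_alpha k.+1 r| <= A * `|t| ^+ r.
Proof.
have [t1 _ _] := t_adm.
have [M M0 pM] := pochn_bounded K_complete q_lt1 t.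
have [B B0 hB] : bounded_seq (unit_alpha q t).
  rewrite /unit_alpha; under eq_fun do rewrite invfM mulrA.
  have := @bounded_seq_pochnqV _ K_complete _ q_lt1 0.
  under eq_fun do rewrite addn0.
  apply: bounded_seqM; apply: bounded_seqM; last exact: bounded_seq_cst.
  apply: bounded_seqM; last by exists M.
  apply: bounded_seqM; last first.
    apply: bounded_seqB; first exact: bounded_seq_cst.
    by apply: bounded_seqM; [exact: bounded_seq_cst|exact: bounded_seqX].
  apply: bounded_seqM; last exact: bounded_seqX.
  by exists 1 => // s; rewrite normrX normrN1 expr1n.
exists B => // r; rewrite /bailey_alpha normrM mulrC; apply: ler_pM => //.
rewrite exprS -mulrA normrM normrX -[leRHS]mulr1; apply: ler_wpM2l.
  exact: exprn_ge0.
rewrite normrM !normrX !normrM !normrX.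
have q1 : `|q| ^+ (r ^ 2) <= 1 by rewrite exprn_ile1 // ltW.
have tr1 : `|t| ^+ r <= 1 by rewrite exprn_ile1 // ltW.
have tq0 : 0 <= `|t| ^+ r * `|q| ^+ (r ^ 2) by apply: mulr_ge0; apply: exprn_ge0.
have tq1 : `|t| ^+ r * `|q| ^+ (r ^ 2) <= 1 by apply: mulr_ile1 => //; apply: exprn_ge0.
apply: mulr_ile1 => //; [exact: exprn_ge0|exact: exprn_ge0|exact: exprn_ile1].
Qed.

(** The sum over n >= r of t^n H_(2n) / ((q)_(n-r) (tq)_(n+r)), with n = r + s and 1/(tq)_(2r+s)
    written as (t q^(2r+s+1))_oo / (tq)_oo. *)
Definition bailey_gamma r : K := t ^+ r / qpochinf (t * q) q * gen_sum q z t (2 * r).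

Lemma tq_lt1 : `|t * q| < 1.
Proof. by have [t1 _ _] := t_adm; rewrite -[q]expr1; apply: norm_mulXn_lt1. Qed.

(** The Bailey transform: sum delta_n beta_n = sum alpha_r gamma_r with delta_n = t^n H_(2n). The
    exchange is dominated by a multiple of t^r in r and by delta_(r+s). *)
Lemma has_sum_bailey k :
  abs_summable (fun r => bailey_alpha k.+1 r * bailey_gamma r) /\
  has_sum (fun n => t ^+ n * bailey_beta q t k.+1 n * qhermite q z (2 * n))
          (limn (series (fun r => bailey_alpha k.+1 r * bailey_gamma r))).
Proof.
have [t1 _ _] := t_adm; have tq1 := tq_lt1.
have nr := q_nroot q_lt1.
have tnr n : 1 - t * q ^+ n != 0 by apply/one_sub_neq0/norm_mulXn_lt1.
have [A A0 hA] := bailey_alpha_le k.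
have [B B0 pB] := pochnV_bounded K_complete q_lt1 q_lt1.
have [D D0 pD] := pochnV_bounded K_complete q_lt1 tq1.
pose f r s := bailey_alpha k.+1 r / (pochn q q s * pochn (t * q) q (2 * r + s))
              * (t ^+ (r + s) * qhermite q z (2 * (r + s))).
have fE : (fun n => t ^+ n * bailey_beta q t k.+1 n * qhermite q z (2 * n))
          = (fun n => \sum_(r < n.+1) f r (n - r)%N).
  apply/funext => n; rewrite bailey_chain // mulr_sumr mulr_suml.
  apply: eq_bigr => r _; have rn : (r <= n)%N by rewrite -ltnS.
  rewrite /f subnKC // -/(bailey_alpha k.+1 r).
  have -> : (2 * r + (n - r) = n + r)%N by lia.
  by ring.
rewrite fE; apply: (@has_sum_triangle _ K_complete f
  (fun r => A * B * D * t ^+ r) (fun n => 1 * (t ^+ n * qhermite q z (2 * n + 0)))).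
- move=> r s; rewrite /f addn0 mul1r (normrM (_ / _)); apply: ler_wpM2r => //.
  have ABD0 : 0 <= A * B * D by rewrite !mulr_ge0.
  rewrite (normrM (A * B * D)) (ger0_norm ABD0) normrX.
  have -> : A * B * D * `|t| ^+ r = A * `|t| ^+ r * (B * D) by ring.
  by rewrite normrM; apply: ler_pM => //; rewrite invfM normrM; apply: ler_pM.
- apply: (@abs_summable_le _ _ (fun r => t ^+ r) `|A * B * D|) => //.
    by move=> r; rewrite normrM.
  exact: abs_summable_geometric.
- by apply: abs_summable_qhermite => //; apply: bounded_seq_cst.
move=> r; rewrite /bailey_gamma mulrA.
have := has_sumZ (bailey_alpha k.+1 r * (t ^+ r / qpochinf (t * q) q))
   (@gen_sumP _ K_complete _ _ q_lt1 z_neq0 t (2 * r) t_adm).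
congr (has_sum _ _); apply/funext => s; rewrite /f /gen_coef.
have tq0 := qpochinf_neq0 K_complete q_lt1 tq1.
have hE : qpochinf (t * q ^+ (s + 2 * r).+1) q
          = qpochinf (t * q) q / pochn (t * q) q (2 * r + s).
  rewrite (qpochinf_split K_complete q_lt1 (t * q) (2 * r + s)) mulrAC mulfV ?mul1r.
    by rewrite -mulrA -exprS addnC.
  exact: pochn_neq0.
rewrite hE exprD.
have -> : (2 * s + 2 * r = 2 * (r + s))%N by lia.
have h1 := pochn_neq0 q_lt1 s q_lt1; have h2 := pochn_neq0 q_lt1 (2 * r + s) tq1.
by field; rewrite h1 h2 tq0.
Qed.

(** By [gen_sumE] at m = 2r only products remain. The splittings (q)_(2r) = (q)_r (q^(r+1))_r and (1
    - t)(tq)_(2r) = (t)_r (t q^r)_r (1 - t q^(2r)) cancel the factors of [unit_alpha]. *)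
Lemma bailey_alpha_gamma k r :
  gen_den q z t * (bailey_alpha k r * bailey_gamma r) = rhs_term k q t z r.
Proof.
have [t1 _ _] := t_adm; have tq1 := tq_lt1.
rewrite /bailey_gamma /rhs_term.
have -> : \sum_(j < (2 * r).+1)
      (qpoch t q j * qpoch t q (2 * r - j)) / (qpoch q q j * qpoch q q (2 * r - j))
      * z ^ ((2 * j)%N%:Z - (2 * r)%N%:Z) = rogers q t z (2 * r).
  apply: eq_bigr => j _; have jr : (j <= 2 * r)%N by rewrite -ltnS.
  by rewrite exprz_laurent // !qpochE // /rogers_coef invfM; ring.
rewrite mulrCA [gen_den _ _ _ * _]mulrCA (gen_sumE K_complete q_lt1 z_neq0 _ t_adm).
have qr1 : `|q ^+ r.+1| < 1 by rewrite exprS norm_mulXn_lt1.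
have tr1 : `|t * q ^+ r| < 1 by rewrite norm_mulXn_lt1.
rewrite !qpochE //.
have tq0 := qpochinf_neq0 K_complete q_lt1 tq1.
have r2 : (2 * r = r + r)%N by lia.
have e1 : pochn q q (2 * r) = pochn q q r * pochn (q ^+ r.+1) q r.
  by rewrite r2 pochnD -exprS.
have e2 : pochn t q (2 * r) = pochn t q r * pochn (t * q ^+ r) q r.
  by rewrite r2 pochnD.
have e3 : (1 - t) * pochn (t * q) q (2 * r)
          = pochn t q r * pochn (t * q ^+ r) q r * (1 - t * q ^+ (2 * r)).
  by rewrite -pochnSl pochnS e2.
have e4 := qpochinf_split K_complete q_lt1 (t * q) (2 * r).
rewrite -mulrA -exprS in e4.
have n1 : 1 - t != 0 by exact: one_sub_neq0.
have n2 : pochn q q r != 0 by exact: pochn_neq0.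
have n3 : pochn t q r != 0 by exact: pochn_neq0.
have n4 : pochn (t * q ^+ r) q r != 0 by exact: pochn_neq0.
have n5 : 1 - t * q ^+ (2 * r) != 0 by apply/one_sub_neq0/norm_mulXn_lt1.
have n6 : qpochinf (t * q ^+ (2 * r).+1) q != 0.
  by apply/qpochinf_neq0 => //; apply: norm_mulXn_lt1.
have e5 : pochn (t * q) q (2 * r)
          = pochn t q r * pochn (t * q ^+ r) q r * (1 - t * q ^+ (2 * r)) / (1 - t).
  by rewrite -e3 mulrAC mulfV ?mul1r.
rewrite e4 e5 e1 /bailey_alpha /unit_alpha.
have -> : t ^+ (k.+1 * r) = (t ^+ r) ^+ k * t ^+ r by rewrite mulSn addnC exprD mulnC exprM.
have -> : q ^+ (k * r ^ 2 + 'C(r, 2)) = (q ^+ (r ^ 2)) ^+ k * q ^+ 'C(r, 2).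
  by rewrite exprD mulnC exprM.
rewrite exprMn.
by field; rewrite n1 n2 n3 n4 n5 n6.
Qed.

(** Grouping chains by their last entry turns the left side into sum t^n H_(2n) beta_n, hence into L
    = sum alpha_r gamma_r; the right-hand series is [gen_den] times L. *)
Theorem qseries_identity k : (1 <= k)%N ->
  [/\ multisum_cvg (fun n : chain k => lhs_term q t z n),
      sum_nat_cvg (rhs_term k q t z) &
      multisum (fun n : chain k => lhs_term q t z n)
      = 1 / qpochsinf [:: t; t * z ^+ 2; t * z ^- 2] q
        * sum_nat (rhs_term k q t z)].
Proof.
case: k => // k _; have [t1 _ _] := t_adm.
have [sg hs] := has_sum_bailey k.
set L := limn _ in hs.
have [C C0 hC] := sum_norm_chain_weight k.
pose F s := chain_weight q t k s * qhermite q z (2 * last 0%N s).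
have lhs_cvg : partial_sum (fun n : chain k.+1 => lhs_term q t z n) @ totally --> L.
  have -> : (fun n : chain k.+1 => lhs_term q t z n) = (fun n => F (tval (val n))).
    by apply/funext => n; rewrite lhs_termE.
  (* A sequence is turned back into a chain by checking first its length, then its order. *)
  pose inv (s : seq nat) : option (chain k.+1) :=
    obind insub (insub s : option (k.+1.-tuple nat)).
  apply: (@multisum_height _ K_complete _ _ (fun n : chain k.+1 => tval (val n)) inv
    (last 0%N) (chains k) (fun s => (size s == k.+1) && sorted leq s) F
    (fun n => `|C * (t ^+ n * qhermite q z (2 * n + 0))|)).
  - by move=> n; rewrite /inv valK /= valK.
  - by move=> n; rewrite size_tuple eqxx (valP n).
  - move=> s /andP[ss sos].
    by exists (exist (fun n : k.+1.-tuple nat => sorted leq n) (Tuple ss) sos).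
  - exact: uniq_chains.
  - by move=> n s; rewrite mem_chains andbA.
  - move=> n; rewrite /F addn0 normrM (ger0_norm C0) (normrM (t ^+ n)) mulrA normrX.
    apply: le_trans (ler_wpM2r (normr_ge0 _) (hC n)).
    rewrite mulr_suml le_eqVlt; apply/orP; left; apply/eqP.
    apply: eq_big_seq => s; rewrite mem_chains => /and3P[_ _ /eqP ->].
    by rewrite normrM.
  - have [M hM] := abs_summable_qhermite K_complete q_lt1 z_neq0 0 t_adm (bounded_seq_cst C).
    by exists M => N; under eq_bigr do rewrite normr_id.
  move: hs; congr (has_sum _ _); apply/funext => n.
  rewrite -sum_chain_weight mulr_suml; apply: eq_big_seq => s.
  by rewrite mem_chains /F => /and3P[_ _ /eqP ->].
have rhs_sum : has_sum (rhs_term k.+1 q t z) (gen_den q z t * L).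
  have := has_sumZ (gen_den q z t) (abs_summable_has_sum K_complete sg).
  by congr (has_sum _ _); apply/funext => r; rewrite bailey_alpha_gamma.
split.
- by apply/cvg_ex; exists L.
- by apply/cvg_ex; exists (gen_den q z t * L).
have -> : multisum (fun n : chain k.+1 => lhs_term q t z n) = L by exact: cvg_lim.
have -> : sum_nat (rhs_term k.+1 q t z) = gen_den q z t * L by exact: has_sum_lim.
have -> : qpochsinf [:: t; t * z ^+ 2; t * z ^- 2] q = gen_den q z t.
  by rewrite /qpochsinf !big_cons big_nil mulr1 /gen_den mulrA.
by rewrite mul1r mulKf // gen_den_neq0.
Qed.

End Main.

Theorem theorem1p2 (R : realType) (k : nat) (q t z : R[i])
    (k_ge1 : (1 <= k)%N) (q_lt1 : `|q| < 1) (t_lt1 : `|t| < 1) (z_neq0 : z != 0)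
    (tz_lt1 : `|t * z ^+ 2| < 1) (tzV_lt1 : `|t * z ^- 2| < 1) :
  [/\ multisum_cvg (fun n : chain k => lhs_term q t z n),
      sum_nat_cvg (rhs_term k q t z) &
      multisum (fun n : chain k => lhs_term q t z n)
      = 1 / qpochsinf [:: t; t * z ^+ 2; t * z ^- 2] q
        * sum_nat (rhs_term k q t z)].
Proof.
by apply: qseries_identity => //; apply: abs_summable_complex.
Qed.
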